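(* Let $m>2$ be an integer and $\tilde j_m=-m/2-1$. Let $K_{\Delta_k}(\cdot;m)$, $H_{\Delta_k}(\cdot,\cdot;m)$ be the spectral functions of the modular curvature given in the context, and let $$T(u)=T_{\Delta_\varphi}(u;m)=-K_{\Delta_k}(1;m)\,\frac{u^{-m/2}-1}{u-1}+H_{\Delta_k}(u,u^{-1};m),\qquad u>0,$$ be the spectral function of the Einstein–Hilbert action. Then for all $u,v>0$, with $j=\tilde j_m$, $$\frac{2-m}{2}K_{\Delta_k}(u;m)=-T(u)-u^jT(u^{-1}),\qquad \frac{2-m}{2}H_{\Delta_k}(u,v;m)=\sum_{\beta=1}^4\mathrm{II}^{(\beta)}(T;j)(u,v),$$ where $$\mathrm{II}^{(1)}(T;j)(u,v)=T(u)\frac{(uv)^j-1}{uv-1},$$ $$\mathrm{II}^{(2)}(T;j)(u,v)=\frac{u^{j-1}(T(u^{-1})-T(v))}{u^{-1}-v}-\frac{u(uv)^{j-1}(T(v^{-1})-T(u))}{v^{-1}-u},$$ $$\mathrm{II}^{(3)}(T;j)(u,v)=-\frac{(u^j-1)T(v)}{u-1}+\frac{v(T(uv)-T(v))}{uv-v}-\frac{T(uv)-T(u)}{uv-u},$$ $$\mathrm{II}^{(4)}(T;j)(u,v)=-\frac{(u^j-1)v^jT(v^{-1})}{u-1}-\frac{(uv)^jT((uv)^{-1})-u^jT(u^{-1})}{uv-u}+\frac{v\big((uv)^jT((uv)^{-1})-v^jT(v^{-1})\big)}{uv-v}.$$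
   Context: For $s,t>0$, $$K_{\Delta_k}(s;m)=-\tfrac12\Gamma(\tfrac m2+1)\,{}_2F_1(\tfrac m2+1,1;3;1-s)+\tfrac{2}{3m}\Gamma(\tfrac m2+2)\,{}_2F_1(\tfrac m2+2,1;4;1-s),$$ $$H_{\Delta_k}(s,t;m)=\tfrac1{6m}\Big[2(m+2)\Gamma(\tfrac m2+2)F_1(\tfrac m2+2;1,1;4;1-st,1-s)-2\Gamma(\tfrac m2+3)F_1(\tfrac m2+3;1,1;5;1-st,1-s)-s\,\Gamma(\tfrac m2+3)F_1(\tfrac m2+3;1,2;5;1-st,1-s)\Big],$$ with ${}_2F_1$ Gauss's hypergeometric function and $F_1$ Appell's first function, given for real $x,y<1$ by $$F_1(\alpha;\beta,\beta';\gamma;x,y)=\frac{\Gamma(\gamma)}{\Gamma(\beta)\Gamma(\beta')\Gamma(\gamma-\beta-\beta')}\int_{p,q\ge0,\,p+q\le1}p^{\beta-1}q^{\beta'-1}(1-p-q)^{\gamma-\beta-\beta'-1}(1-xp-yq)^{-\alpha}dp\,dq.$$ All quotients are extended continuously to points where a denominator vanishes. (Geometrically: $K_{\Delta_k},H_{\Delta_k}$ are the one- and two-variable functions of the modular operator in the density of the second heat coefficient of $k\Delta$ on a noncommutative $m$-torus, $k$ a Weyl factor; $T_{\Delta_\varphi}$ is the one-variable function in the local formula for the second heat coefficient $V_2(1,k^{1/2}\Delta k^{1/2})$.) *)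

(* Defs.v *)
From Stdlib Require Import Reals.
From Coquelicot Require Import Coquelicot.
Open Scope R_scope.

(** The integrals below are improper at every endpoint: the integrands are
    powers (real exponents, [Rpower]) of quantities that are positive in the
    interior of the domain, and [Rpower 0 x] is not the power 0^x. *)

Definition Gamma (z : R) : R :=
  RInt_gen (fun t => Rpower t (z - 1) * exp (- t))
    (at_right 0) (Rbar_locally p_infty).

(** Gauss's function on the whole half-line [x < 1], for [0 < b < c]: Euler's
    integral, which is the analytic continuation of the Gauss series from
    [-1 < x < 1] to [x < 1]. *)
Definition hyp2F1 (a b c x : R) : R :=
  Gamma c / (Gamma b * Gamma (c - b)) *
  RInt_gen
    (fun t => Rpower t (b - 1) * Rpower (1 - t) (c - b - 1)
              * Rpower (1 - x * t) (- a))
    (at_right 0) (at_left 1).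

(** Appell's F1 for [x, y < 1], [b, b', c - b - b' > 0].  The integral over the
    simplex [p, q >= 0, p + q <= 1] is iterated: the integrand is positive, so
    by Tonelli it is the same as the double integral. *)
Definition appellF1 (a b b' c x y : R) : R :=
  Gamma c / (Gamma b * Gamma b' * Gamma (c - b - b')) *
  RInt_gen
    (fun p =>
       RInt_gen
         (fun q => Rpower p (b - 1) * Rpower q (b' - 1)
                   * Rpower (1 - p - q) (c - b - b' - 1)
                   * Rpower (1 - x * p - y * q) (- a))
         (at_right 0) (at_left (1 - p)))
    (at_right 0) (at_left 1).

(** The quotient [N / D] extended continuously to the zeros of [D]: at such a
    point its value is the limit of [N / D] along [D <> 0]. *)
Definition quot {U : UniformSpace} (N D : U -> R) (p : U) : R :=
  if Req_EM_T (D p) 0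
  then iota (fun l : R =>
         filterlim (fun q => N q / D q)
           (within (fun q => D q <> 0) (locally p)) (locally l))
  else N p / D p.

(** The extension in two variables is by the joint limit in [(u, v)]. *)
Definition quot2 (N D : R -> R -> R) (u v : R) : R :=
  quot (fun p : R * R => N (fst p) (snd p))
       (fun p : R * R => D (fst p) (snd p)) (u, v).

Lemma quot_regular (U : UniformSpace) (N D : U -> R) (p : U) :
  D p <> 0 -> quot N D p = N p / D p.
Proof. intros Hp; unfold quot; destruct (Req_EM_T (D p) 0); easy. Qed.

Lemma quot_limit (U : UniformSpace) (N D : U -> R) (p : U) (l : R) :
  D p = 0 ->
  (forall P, locally p P -> exists q, P q /\ D q <> 0) ->
  filterlim (fun q => N q / D q)
    (within (fun q => D q <> 0) (locally p)) (locally l) ->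
  quot N D p = l.
Proof.
intros Hp Hdense Hl; unfold quot; destruct (Req_EM_T (D p) 0) as [_|]; [|easy].
assert (HF : ProperFilter' (within (fun q => D q <> 0) (locally p))).
{ split.
  - intros H; destruct (Hdense _ H) as [q [Hq Dq]]; exact (Hq Dq).
  - apply within_filter, locally_filter. }
exact (iota_filterlim_locally (V := R_CompleteNormedModule) _ l Hl).
Qed.

Definition K_Dk (s m : R) : R :=
  - (1 / 2) * Gamma (m / 2 + 1) * hyp2F1 (m / 2 + 1) 1 3 (1 - s)
  + 2 / (3 * m) * Gamma (m / 2 + 2) * hyp2F1 (m / 2 + 2) 1 4 (1 - s).

Definition H_Dk (s t m : R) : R :=
  1 / (6 * m) *
  (2 * (m + 2) * Gamma (m / 2 + 2)
     * appellF1 (m / 2 + 2) 1 1 4 (1 - s * t) (1 - s)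
   - 2 * Gamma (m / 2 + 3)
     * appellF1 (m / 2 + 3) 1 1 5 (1 - s * t) (1 - s)
   - s * Gamma (m / 2 + 3)
     * appellF1 (m / 2 + 3) 1 2 5 (1 - s * t) (1 - s)).

Definition T_Dphi (u m : R) : R :=
  - K_Dk 1 m * quot (fun w : R => Rpower w (- m / 2) - 1) (fun w : R => w - 1) u
  + H_Dk u (/ u) m.

Definition II1 (T : R -> R) (j u v : R) : R :=
  T u * quot2 (fun u v => Rpower (u * v) j - 1) (fun u v => u * v - 1) u v.

Definition II2 (T : R -> R) (j u v : R) : R :=
  quot2 (fun u v => Rpower u (j - 1) * (T (/ u) - T v))
        (fun u v => / u - v) u v
  - quot2 (fun u v => u * Rpower (u * v) (j - 1) * (T (/ v) - T u))
          (fun u v => / v - u) u v.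

Definition II3 (T : R -> R) (j u v : R) : R :=
  - quot2 (fun u v => (Rpower u j - 1) * T v) (fun u v => u - 1) u v
  + quot2 (fun u v => v * (T (u * v) - T v)) (fun u v => u * v - v) u v
  - quot2 (fun u v => T (u * v) - T u) (fun u v => u * v - u) u v.

Definition II4 (T : R -> R) (j u v : R) : R :=
  - quot2 (fun u v => (Rpower u j - 1) * Rpower v j * T (/ v))
          (fun u v => u - 1) u v
  - quot2 (fun u v => Rpower (u * v) j * T (/ (u * v)) - Rpower u j * T (/ u))
          (fun u v => u * v - u) u v
  + quot2 (fun u v => v * (Rpower (u * v) j * T (/ (u * v))
                           - Rpower v j * T (/ v)))
          (fun u v => u * v - v) u v.

(* Main.v *)
Require Import Defs.
From Stdlib Require Import Reals Factorial Lra Classical IndefiniteDescription.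
From Coquelicot Require Import Coquelicot.
Open Scope R_scope.

(** Write [a = m / 2], [f(z) = z^(1-a)], [w = s t], and let [f[x0,...,xn]] be
    divided differences.  By the Hermite-Genocchi formula an integral of a power
    of the barycentre of [1, s, w] over the simplex, with polynomial weights, is a
    divided difference of [f] with repeated nodes.  Euler's identity for the
    homogeneous function [f] then merges the hypergeometric terms:

      K(s)    =   c  d/ds (s f[1,1,s]),
      H(s, t) = 2 c  d/dw (w f[1,1,s,w]),      c = Gamma(a) / (a (a - 1)).

    On the level of integrals this is [K_Dk_integral] and [H_Dk_integral]; both
    use [Gamma (z + 1) = z Gamma z], for which the convergence of the Gamma
    integral has to be known ([Gamma_succ]).

    The recursion of divided differences expresses H through functions of fewer
    nodes as soon as [s <> 1] ([H_Dk_reduction]), and these are elementary.  So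
    when none of u, v, uv is 1, every term of the theorem is [Gamma (a + 1)] times
    a rational function of a, u, v, u^(-a), v^(-a), and both equations become
    identities of rational functions in five independent variables
    ([K_identity_generic], [H_identity_generic]).

    The remaining points are reached by continuity.  The left sides are continuous
    as parameter integrals.  On the right, each extended quotient is a difference
    quotient of T, of a power, or of [x^j T(1/x)].  These functions have slope
    functions, [f x - f y = D x y (x - y)] with D jointly continuous
    ([has_slope]): for a power, D is an integral of its derivative, and T inherits
    one because it is an integral of powers ([T_Dphi_slope]).  Hence the quotients
    are the values of continuous functions ([II_sum_slopes]), and the equations
    extend from the generic points, which are dense. *)

(** * Powers, integrals, limits *)

Lemma ex_derive_continuous_R (f : R -> R) (x : R) : ex_derive f x -> continuous f x.
Proof. apply (ex_derive_continuous (V := R_NormedModule)). Qed.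

Lemma is_RInt_const_R (a b c : R) : is_RInt (fun _ => c) a b ((b - a) * c).
Proof. apply (is_RInt_const (V := R_NormedModule) a b c). Qed.

Lemma is_RInt_ge_0 (f : R -> R) (a b l : R) :
  a <= b -> is_RInt f a b l -> (forall x, a < x < b -> 0 <= f x) -> 0 <= l.
Proof.
intros Hab Hl Hf; rewrite <- (Rmult_0_r (b - a)).
apply (is_RInt_le (fun _ => 0) f a b); [easy|apply is_RInt_const_R|easy|easy].
Qed.

Lemma is_derive_Rpower (c x : R) :
  0 < x -> is_derive (fun y => Rpower y c) x (c * Rpower x (c - 1)).
Proof.
intros Hx; unfold Rpower; auto_derive; [easy|].
replace ((c - 1) * ln x) with (c * ln x + - ln x) by ring.
rewrite exp_plus, exp_Ropp, exp_ln by easy; field; lra.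
Qed.

Lemma Rpower_pred (x c : R) : 0 < x -> Rpower x (c - 1) = Rpower x c / x.
Proof.
intros Hx; unfold Rpower.
replace ((c - 1) * ln x) with (c * ln x + - ln x) by ring.
now rewrite exp_plus, exp_Ropp, exp_ln.
Qed.

Lemma exp_nondecreasing (x y : R) : x <= y -> exp x <= exp y.
Proof. intros [H| ->]; [left; now apply exp_increasing|apply Rle_refl]. Qed.

Lemma Rpower_pos (x c : R) : 0 < Rpower x c.
Proof. apply exp_pos. Qed.

Lemma filterlim_R {T : Type} (F : (T -> Prop) -> Prop) {FF : Filter F}
  (f : T -> R) (l : R) :
  (forall eps : posreal, F (fun x => Rabs (f x - l) < eps)) ->
  filterlim f F (locally l).
Proof. intros H; apply filterlim_locally; exact H. Qed.

(** An improper integral is the difference of the limits of a primitive.  The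
    primitive is only asked to compute the proper integrals over a set [D] seen
    by both filters, so that the statement covers the half-line and bounded open
    intervals alike. *)
Lemma RInt_gen_primitive (Fa Fb : (R -> Prop) -> Prop)
  {FFa : ProperFilter Fa} {FFb : ProperFilter Fb}
  (f G : R -> R) (D : R -> Prop) (la lb : R) :
  Fa D -> Fb D ->
  (forall x y, D x -> D y -> is_RInt f x y (G y - G x)) ->
  filterlim G Fa (locally la) -> filterlim G Fb (locally lb) ->
  RInt_gen f Fa Fb = lb - la.
Proof.
intros Ha Hb HG Hla Hlb.
apply (is_RInt_gen_unique (V := R_CompleteNormedModule)
         (FFa := Proper_StrongProper _ FFa) (FFb := Proper_StrongProper _ FFb)).
apply filterlimi_locally; intros eps.
assert (He : 0 < eps / 2) by (destruct eps; simpl; lra).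
pose proof (proj1 (filterlim_locally _ _) Hla (mkposreal _ He)) as Ea.
pose proof (proj1 (filterlim_locally _ _) Hlb (mkposreal _ He)) as Eb.
refine (Filter_prod _ _ _ _ _ (filter_and _ _ Ha Ea) (filter_and _ _ Hb Eb) _).
intros x y [Dx Bx] [Dy By]; exists (G y - G x); split; [now apply HG|].
change (Rabs (G x - la) < eps / 2) in Bx; change (Rabs (G y - lb) < eps / 2) in By.
change (Rabs ((G y - G x) - (lb - la)) < eps).
apply Rabs_def2 in Bx; apply Rabs_def2 in By; apply Rabs_def1; lra.
Qed.

(** * The Gamma function *)

Definition Gamma_integrand (z t : R) : R := Rpower t (z - 1) * exp (- t).

Lemma Gamma_integrand_pos (z t : R) : 0 < Gamma_integrand z t.
Proof. apply Rmult_lt_0_compat; apply exp_pos. Qed.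

Lemma Gamma_integrand_continuous (z t : R) :
  0 < t -> continuous (Gamma_integrand z) t.
Proof.
intros Ht; apply ex_derive_continuous_R; unfold Gamma_integrand, Rpower.
auto_derive; easy.
Qed.

Lemma Gamma_integrand_RInt (z x y : R) :
  0 < x -> 0 < y -> ex_RInt (Gamma_integrand z) x y.
Proof.
intros Hx Hy; apply (ex_RInt_continuous (V := R_CompleteNormedModule)).
intros t Ht; apply Gamma_integrand_continuous.
pose proof (Rmin_glb_lt _ _ _ Hx Hy); lra.
Qed.

(** For [z < 1] the integrand is unbounded at 0. *)
Lemma Gamma_integrand_bound0 (z t : R) :
  1 <= z -> 0 < t <= 1 -> Gamma_integrand z t <= 1.
Proof.
intros Hz Ht; unfold Gamma_integrand, Rpower; rewrite <- exp_plus.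
assert (ln t <= 0) by (rewrite <- ln_1; apply Rcomplements.ln_le; lra).
apply Rle_trans with (exp 0); [apply exp_nondecreasing|rewrite exp_0; lra].
assert (0 <= (z - 1) * - ln t) by (apply Rmult_le_pos; lra). lra.
Qed.

(** The maximum of [t^n e^(-t)] is attained at [t = n]; it comes from
    [ln x <= x - 1] at [x = t / n]. *)
Lemma Rpower_exp_bound (n t : R) :
  0 < n -> 0 < t -> Rpower t n * exp (- t) <= exp (n * ln n - n).
Proof.
intros Hn Ht; unfold Rpower; rewrite <- exp_plus.
assert (H : ln t - ln n <= t / n - 1).
{ rewrite <- ln_div by easy.
  assert (0 < t / n) by (apply Rdiv_lt_0_compat; lra).
  destruct (Req_dec (ln (t / n)) 0) as [E|E].
  - rewrite E; rewrite <- (exp_ln (t / n)), E, exp_0 by easy; lra.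
  - pose proof (exp_ineq1 _ E) as I; rewrite exp_ln in I by easy; lra. }
assert (n * (ln t - ln n) <= t - n).
{ replace (t - n) with (n * (t / n - 1)) by (field; lra).
  apply Rmult_le_compat_l; lra. }
apply exp_nondecreasing; lra.
Qed.

(** The maximum of [t^(z+1) e^(-t)], which compares the integrand with [1 / t^2]
    at infinity. *)
Definition Gamma_const (z : R) : R := exp ((z + 1) * ln (z + 1) - (z + 1)).

Lemma Gamma_integrand_bound_infty (z t : R) :
  1 <= z -> 0 < t -> Gamma_integrand z t <= Gamma_const z * / t ^ 2.
Proof.
intros Hz Ht.
pose proof (Rpower_exp_bound (z + 1) t ltac:(lra) Ht) as B.
fold (Gamma_const z) in B.
replace (Gamma_integrand z t) with (Rpower t (z + 1) * exp (- t) * / t ^ 2).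
- apply Rmult_le_compat_r; [left; apply Rinv_0_lt_compat; nra|easy].
- unfold Gamma_integrand.
  replace (z + 1) with ((z - 1) + 1 + 1) by ring.
  rewrite !Rpower_plus, Rpower_1 by easy; field; lra.
Qed.

Definition Gamma_partial (z t : R) : R := RInt (Gamma_integrand z) 1 t.

Lemma Gamma_partial_diff (z x y : R) :
  0 < x -> 0 < y ->
  is_RInt (Gamma_integrand z) x y (Gamma_partial z y - Gamma_partial z x).
Proof.
intros Hx Hy.
replace (Gamma_partial z y - Gamma_partial z x) with (RInt (Gamma_integrand z) x y).
- apply (RInt_correct (V := R_CompleteNormedModule)); now apply Gamma_integrand_RInt.
- assert (C : RInt (Gamma_integrand z) 1 x + RInt (Gamma_integrand z) x y
              = RInt (Gamma_integrand z) 1 y)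
    by (apply (RInt_Chasles (V := R_CompleteNormedModule));
        apply Gamma_integrand_RInt; lra).
  unfold Gamma_partial; lra.
Qed.

Lemma Gamma_partial_near_0 (z x y : R) :
  1 <= z -> 0 < x <= y -> y <= 1 ->
  0 <= Gamma_partial z y - Gamma_partial z x <= y.
Proof.
intros Hz Hx Hy.
pose proof (Gamma_partial_diff z x y ltac:(lra) ltac:(lra)) as H; split.
- apply (is_RInt_ge_0 (Gamma_integrand z) x y); [lra|easy|].
  intros; left; apply Gamma_integrand_pos.
- apply Rle_trans with ((y - x) * 1); [|lra].
  apply (is_RInt_le (Gamma_integrand z) (fun _ => 1) x y); [lra|easy| |].
  + apply is_RInt_const_R.
  + intros t Ht; apply Gamma_integrand_bound0; lra.
Qed.

Lemma Gamma_partial_near_infty (z x y : R) :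
  1 <= z -> 0 < x <= y ->
  0 <= Gamma_partial z y - Gamma_partial z x <= Gamma_const z / x.
Proof.
intros Hz Hx.
assert (HC : 0 < Gamma_const z) by apply exp_pos.
pose proof (Gamma_partial_diff z x y ltac:(lra) ltac:(lra)) as H; split.
- apply (is_RInt_ge_0 (Gamma_integrand z) x y); [lra|easy|].
  intros; left; apply Gamma_integrand_pos.
- apply Rle_trans with (- Gamma_const z / y - - Gamma_const z / x).
  + apply (is_RInt_le (Gamma_integrand z) (fun t => Gamma_const z * / t ^ 2) x y);
      [lra|easy| |].
    * apply (is_RInt_derive (V := R_CompleteNormedModule)
               (fun t => - Gamma_const z / t)); intros t;
        rewrite Rmin_left, Rmax_right by lra; intros Ht.
      -- auto_derive; [lra|field; lra].
      -- apply ex_derive_continuous_R; auto_derive; nra.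
    * intros t Ht; apply Gamma_integrand_bound_infty; lra.
  + unfold Rdiv; assert (0 < / y) by (apply Rinv_0_lt_compat; lra); nra.
Qed.

Lemma at_right_0_lt (d : R) : 0 < d -> at_right 0 (fun x => 0 < x < d).
Proof.
intros Hd; exists (mkposreal d Hd); intros y Hy Hpos.
change (Rabs (y - 0) < d) in Hy; apply Rabs_def2 in Hy; lra.
Qed.

(** Cauchy's criterion at both ends, from the two bounds on the integrand. *)
Lemma Gamma_partial_cv (z : R) :
  1 <= z ->
  (exists l, filterlim (Gamma_partial z) (at_right 0) (locally l)) /\
  (exists l, filterlim (Gamma_partial z) (Rbar_locally p_infty) (locally l)).
Proof.
intros Hz; split;
  apply (filterlim_locally_cauchy (U := R_CompleteNormedModule)); intros eps.
- exists (fun x => 0 < x < Rmin 1 eps); split.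
  { apply at_right_0_lt, Rmin_glb_lt; [lra|apply cond_pos]. }
  assert (W : forall x y, 0 < x < Rmin 1 eps -> 0 < y < Rmin 1 eps -> x <= y ->
            Rabs (Gamma_partial z y - Gamma_partial z x) < eps).
  { intros x y Hx Hy Hxy.
    pose proof (Rmin_l 1 eps); pose proof (Rmin_r 1 eps).
    pose proof (Gamma_partial_near_0 z x y Hz ltac:(lra) ltac:(lra)).
    rewrite Rabs_pos_eq; lra. }
  intros x y Hx Hy; change (Rabs (Gamma_partial z y - Gamma_partial z x) < eps).
  destruct (Rle_dec x y) as [L|L]; [now apply W|].
  rewrite Rabs_minus_sym; apply W; lra.
- set (C := Gamma_const z).
  assert (HC : 0 < C) by apply exp_pos.
  exists (fun x => C / eps < x); split; [now exists (C / eps)|].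
  assert (Hpos : 0 < C / eps) by (apply Rdiv_lt_0_compat; [easy|apply cond_pos]).
  assert (W : forall x y, C / eps < x -> C / eps < y -> x <= y ->
            Rabs (Gamma_partial z y - Gamma_partial z x) < eps).
  { intros x y Hx Hy Hxy.
    pose proof (Gamma_partial_near_infty z x y Hz ltac:(lra)) as B; fold C in B.
    rewrite Rabs_pos_eq by lra; apply Rle_lt_trans with (1 := proj2 B).
    apply Rlt_div_l; [lra|].
    apply Rlt_div_l in Hx; [lra|apply cond_pos]. }
  intros x y Hx Hy; change (Rabs (Gamma_partial z y - Gamma_partial z x) < eps).
  destruct (Rle_dec x y) as [L|L]; [now apply W|].
  rewrite Rabs_minus_sym; apply W; lra.
Qed.

Lemma pos_at_right_0 : at_right 0 (fun x => 0 < x).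
Proof. exists (mkposreal 1 Rlt_0_1); easy. Qed.

Lemma pos_at_infty : Rbar_locally p_infty (fun x => 0 < x).
Proof. now exists 0. Qed.

(** Integration by parts. Once the partial integrals for z converge, a primitive
    for z + 1 is [- t^z e^(-t) + z Gamma_partial z t], whose boundary term vanishes
    at both ends. *)
Lemma Gamma_succ (z : R) : 1 <= z -> Gamma (z + 1) = z * Gamma z.
Proof.
intros Hz.
destruct (Gamma_partial_cv z Hz) as [[l0 H0] [l1 H1]].
assert (E : Gamma z = l1 - l0).
{ apply (RInt_gen_primitive (at_right 0) (Rbar_locally p_infty) _ (Gamma_partial z) (fun x => 0 < x));
    [apply pos_at_right_0|apply pos_at_infty|apply Gamma_partial_diff|easy|easy]. }
rewrite E; replace (z * (l1 - l0)) with ((- 0 + z * l1) - (- 0 + z * l0)) by ring.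
assert (Hz0 : forall F, ProperFilter F ->
  filterlim (fun t => Rpower t z * exp (- t)) F (locally 0) ->
  forall l, filterlim (Gamma_partial z) F (locally l) ->
  filterlim (fun t => - (Rpower t z * exp (- t)) + z * Gamma_partial z t) F
    (locally (- 0 + z * l))).
{ intros F FF Hb l Hl.
  apply (filterlim_comp_2 (fun t => - (Rpower t z * exp (- t)))
           (fun t => z * Gamma_partial z t) Rplus (G := locally (- 0)) (H := locally (z * l))).
  - apply (filterlim_comp _ _ _ _ Ropp F (locally 0)); [easy|].
    apply (filterlim_opp (V := R_NormedModule) 0).
  - apply (filterlim_comp _ _ _ _ (Rmult z) F (locally l)); [easy|].
    apply (filterlim_scal_r (V := R_NormedModule) z l).
  - apply (filterlim_plus (V := R_NormedModule) (- 0) (z * l)). }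
apply (RInt_gen_primitive (at_right 0) (Rbar_locally p_infty) _
         (fun t => - (Rpower t z * exp (- t)) + z * Gamma_partial z t) (fun x => 0 < x));
  [apply pos_at_right_0|apply pos_at_infty| | |].
- intros x y Hx Hy.
  replace (- (Rpower y z * exp (- y)) + z * Gamma_partial z y
           - (- (Rpower x z * exp (- x)) + z * Gamma_partial z x))
    with (plus (minus (- (Rpower y z * exp (- y))) (- (Rpower x z * exp (- x))))
               (scal z (Gamma_partial z y - Gamma_partial z x)))
    by (unfold minus, plus, opp, scal; simpl; unfold mult; simpl; ring).
  apply (is_RInt_ext (V := R_NormedModule)
    (fun t => plus (Rpower t (z + 1 - 1) * exp (- t) - z * (Rpower t (z - 1) * exp (- t)))
                (scal z (Gamma_integrand z t)))).
  { intros t _; unfold plus, scal, Gamma_integrand; simpl; unfold mult; simpl; ring. }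
  apply (is_RInt_plus (V := R_NormedModule)).
  + assert (Hm : forall t, Rmin x y <= t -> 0 < t)
      by (pose proof (Rmin_glb_lt _ _ _ Hx Hy); intros; lra).
    apply (is_RInt_derive (V := R_CompleteNormedModule)
             (fun t => - (Rpower t z * exp (- t)))).
    * intros t [Ht _]; apply Hm in Ht.
      unfold Rpower; auto_derive; [easy|].
      replace (z + 1 - 1) with z by ring.
      replace ((z - 1) * ln t) with (z * ln t + - ln t) by ring.
      rewrite (exp_plus (z * ln t)), (exp_Ropp (ln t)), exp_ln by easy; field; lra.
    * intros t [Ht _]; apply Hm in Ht.
      apply ex_derive_continuous_R; unfold Rpower; auto_derive; easy.
  + apply (is_RInt_scal (V := R_NormedModule)); now apply Gamma_partial_diff.
- apply Hz0; [typeclasses eauto| |easy].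
  apply (filterlim_R (at_right 0)); intros eps.
  refine (filter_imp _ _ _ (at_right_0_lt (Rmin 1 eps)
                              (Rmin_glb_lt _ _ _ Rlt_0_1 (cond_pos eps)))).
  intros t Ht; pose proof (Rmin_l 1 eps); pose proof (Rmin_r 1 eps).
  replace (Rpower t z * exp (- t) - 0) with (t * Gamma_integrand z t).
  + pose proof (Gamma_integrand_pos z t).
    pose proof (Gamma_integrand_bound0 z t Hz ltac:(lra)).
    rewrite Rabs_pos_eq; nra.
  + unfold Gamma_integrand; rewrite Rpower_pred by easy; field; lra.
- apply Hz0; [typeclasses eauto| |easy].
  set (C := Gamma_const z); assert (HC : 0 < C) by apply exp_pos.
  apply (filterlim_R (Rbar_locally p_infty)); intros eps.
  assert (Hpos : 0 < C / eps) by (apply Rdiv_lt_0_compat; [easy|apply cond_pos]).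
  exists (C / eps); intros t; simpl; intros Ht.
  replace (Rpower t z * exp (- t) - 0) with (t * Gamma_integrand z t)
    by (unfold Gamma_integrand; rewrite Rpower_pred by lra; field; lra).
  pose proof (Gamma_integrand_pos z t).
  pose proof (Gamma_integrand_bound_infty z t Hz ltac:(lra)) as B; fold C in B.
  rewrite Rabs_pos_eq by nra.
  apply Rle_lt_trans with (C / t).
  + replace (C / t) with (t * (C * / t ^ 2)) by (field; lra).
    apply Rmult_le_compat_l; lra.
  + apply Rlt_div_l; [lra|].
    apply Rlt_div_l in Ht; [lra|apply cond_pos].
Qed.

Lemma Gamma_1 : Gamma 1 = 1.
Proof.
replace 1 with (- 0 - - 1) at 2 by ring.
apply (RInt_gen_primitive (at_right 0) (Rbar_locally p_infty) _ (fun t => - exp (- t)) (fun x => 0 < x));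
  [apply pos_at_right_0|apply pos_at_infty| | |].
- intros x y Hx Hy.
  assert (Hm : forall t, Rmin x y < t -> 0 < t)
    by (pose proof (Rmin_glb_lt _ _ _ Hx Hy); intros; lra).
  apply (is_RInt_ext (V := R_NormedModule) (fun t => exp (- t))).
  { intros t [Ht _]; rewrite Rminus_diag, Rpower_O by now apply Hm.
    simpl; ring. }
  apply (is_RInt_derive (V := R_CompleteNormedModule) (fun t => - exp (- t)));
    intros t _; [auto_derive; [easy|ring]|].
  apply ex_derive_continuous_R; auto_derive; easy.
- apply (filterlim_filter_le_1 (F := locally 0)); [apply filter_le_within|].
  replace (- 1) with (- exp (- 0)) by (rewrite Ropp_0, exp_0; ring).
  apply (ex_derive_continuous_R (fun t => - exp (- t))); auto_derive; easy.
- apply (filterlim_R (Rbar_locally p_infty)); intros eps.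
  exists (/ eps); intros t Ht.
  pose proof (Rinv_0_lt_compat _ (cond_pos eps)).
  replace (- exp (- t) - - 0) with (- exp (- t)) by ring.
  rewrite Rabs_Ropp, Rabs_pos_eq by (left; apply exp_pos).
  rewrite exp_Ropp; rewrite <- (Rinv_inv eps).
  apply Rinv_lt_contravar; [apply Rmult_lt_0_compat; [easy|apply exp_pos]|].
  pose proof (exp_ineq1 t ltac:(lra)); lra.
Qed.

Lemma Gamma_fact (n : nat) : Gamma (INR n + 1) = INR (fact n).
Proof.
induction n as [|n IH]; [simpl; rewrite Rplus_0_l; apply Gamma_1|].
rewrite Gamma_succ by (pose proof (pos_INR (S n)); rewrite S_INR in *; pose proof (pos_INR n); lra).
rewrite S_INR at 2; rewrite IH.
change (fact (S n)) with (S n * fact n)%nat; now rewrite mult_INR.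
Qed.

(** * Integrals with a parameter *)

(** Removes the improper endpoints: [g] is the continuous extension of the
    integrand to the closed interval. *)
Lemma RInt_gen_open (f g : R -> R) (a b : R) :
  a < b ->
  (forall x, a < x < b -> f x = g x) ->
  (forall x, a <= x <= b -> continuous g x) ->
  RInt_gen f (at_right a) (at_left b) = RInt g a b.
Proof.
intros Hab Hfg Hg.
assert (Hd : 0 < b - a) by lra.
destruct (C0_extension_le g a b Hg) as [h [Hh Ehg]].
assert (Ih : forall x y, ex_RInt h x y)
  by (intros; apply (ex_RInt_continuous (V := R_CompleteNormedModule)); intros; apply Hh).
assert (Ch : forall x, continuous (RInt h a) x).
{ intros x; apply (continuous_RInt_1 h a x), filter_forall; intros z.
  apply (RInt_correct (V := R_CompleteNormedModule)), Ih. }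
assert (Z : RInt h a a = 0) by apply (RInt_point (V := R_CompleteNormedModule)).
replace (RInt g a b) with (RInt h a b - RInt h a a).
2:{ rewrite Z, Rminus_0_r; apply (RInt_ext (V := R_CompleteNormedModule)); intros x.
    rewrite Rmin_left, Rmax_right by lra; intros Hx; apply Ehg; lra. }
apply (RInt_gen_primitive (at_right a) (at_left b) f (RInt h a) (fun x => a < x < b)).
- exists (mkposreal (b - a) Hd); intros y Hy Hay.
  change (Rabs (y - a) < b - a) in Hy; apply Rabs_def2 in Hy; lra.
- exists (mkposreal (b - a) Hd); intros y Hy Hay.
  change (Rabs (y - b) < b - a) in Hy; apply Rabs_def2 in Hy; lra.
- intros x y Hx Hy.
  assert (C : RInt h a x + RInt h x y = RInt h a y)
    by (apply (RInt_Chasles (V := R_CompleteNormedModule)); apply Ih).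
  replace (RInt h a y - RInt h a x) with (RInt h x y) by lra.
  apply (is_RInt_ext (V := R_NormedModule) h).
  + intros t Ht; rewrite Ehg, Hfg; [easy| |];
      revert Ht; unfold Rmin, Rmax; destruct (Rle_dec x y); lra.
  + apply (RInt_correct (V := R_CompleteNormedModule)), Ih.
- apply (filterlim_filter_le_1 (F := locally a)); [apply filter_le_within|apply Ch].
- apply (filterlim_filter_le_1 (F := locally b)); [apply filter_le_within|apply Ch].
Qed.

Lemma RInt_primitive (F f : R -> R) (a b : R) :
  a <= b ->
  (forall x, a <= x <= b -> is_derive F x (f x)) ->
  (forall x, a <= x <= b -> continuous f x) ->
  RInt f a b = F b - F a.
Proof.
intros Hab HF Hf; apply (is_RInt_unique (V := R_CompleteNormedModule)).
apply (is_RInt_derive (V := R_CompleteNormedModule) F f a b);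
  intros x; rewrite Rmin_left, Rmax_right by lra; [apply HF|apply Hf].
Qed.

Lemma RInt_lin (f g : R -> R) (c d : R) :
  ex_RInt f 0 1 -> ex_RInt g 0 1 ->
  RInt (fun t => c * f t + d * g t) 0 1 = c * RInt f 0 1 + d * RInt g 0 1.
Proof.
intros Hf Hg; apply (is_RInt_unique (V := R_CompleteNormedModule)).
apply (is_RInt_plus (V := R_NormedModule) (fun t => c * f t) (fun t => d * g t));
  apply (is_RInt_scal (V := R_NormedModule));
  now apply (RInt_correct (V := R_CompleteNormedModule)).
Qed.

Lemma ex_RInt_01 (f : R -> R) :
  (forall t, 0 <= t <= 1 -> continuous f t) -> ex_RInt f 0 1.
Proof.
intros Hf; apply (ex_RInt_continuous (V := R_CompleteNormedModule)); intros t.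
rewrite Rmin_left, Rmax_right by lra; apply Hf.
Qed.

(** The tube lemma: the compactness of [0, 1] makes a neighbourhood uniform in t. *)
Lemma locally_segment {U : UniformSpace} (P : U * R -> Prop) (x0 : U) :
  (forall t, 0 <= t <= 1 -> locally (x0, t) P) ->
  locally x0 (fun x => forall t, 0 <= t <= 1 -> P (x, t)).
Proof.
intros H.
assert (Hd : forall t, exists d : posreal,
          0 <= t <= 1 -> forall z, ball (x0, t) d z -> P z).
{ intros t; destruct (Rle_dec 0 t); [destruct (Rle_dec t 1)|].
  - destruct (H t (conj r r0)) as [d Hd]; now exists d.
  - exists (mkposreal 1 Rlt_0_1); lra.
  - exists (mkposreal 1 Rlt_0_1); lra. }
destruct (compactness_value_1d 0 1
            (fun t => proj1_sig (constructive_indefinite_description _ (Hd t))))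
  as [d Cd].
exists d; intros x Hx t Ht.
apply NNPP; intros HP; apply (Cd t Ht); intros [s [Hs [Hst Hds]]].
destruct (constructive_indefinite_description _ (Hd s)) as [e He]; simpl in *.
apply HP, He; [easy|split; [now apply ball_le with d|exact Hst]].
Qed.

(** Continuity on a neighbourhood rather than at a point.  A parameter integral is
    continuous at [x] only if the nearby sections are integrable too; with this
    stronger notion the hypothesis and the conclusion of [loc_cont_RInt] have the
    same form, so that it can be iterated for double integrals. *)
Definition loc_cont {U : UniformSpace} (f : U -> R) (x : U) : Prop :=
  locally x (fun y => continuous f y).

Lemma loc_cont_continuous {U : UniformSpace} (f : U -> R) (x : U) :
  loc_cont f x -> continuous f x.
Proof. apply (locally_singleton x (fun y => continuous f y)). Qed.

Lemma loc_cont_RInt {U : UniformSpace} (f : U -> R -> R) (x : U) :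
  (forall t, 0 <= t <= 1 -> loc_cont (fun z : U * R => f (fst z) (snd z)) (x, t)) ->
  loc_cont (fun x => RInt (f x) 0 1) x.
Proof.
intros H.
assert (H' : locally x (fun y => forall t, 0 <= t <= 1 ->
           loc_cont (fun z : U * R => f (fst z) (snd z)) (y, t))).
{ apply (locally_segment (fun z => loc_cont (fun z : U * R => f (fst z) (snd z)) z)).
  intros t Ht; now apply locally_locally, H. }
unfold loc_cont; refine (filter_imp _ _ _ H'); clear x H H'; intros x H.
apply filterlim_locally; intros eps.
assert (He : 0 < eps / 2) by (destruct eps; simpl; lra).
assert (Hc : locally x (fun y => forall t, 0 <= t <= 1 ->
           continuous (fun z : U * R => f (fst z) (snd z)) (y, t))).
{ apply (locally_segment (fun z => continuous (fun z : U * R => f (fst z) (snd z)) z)).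
  exact H. }
assert (Hi : forall y, (forall t, 0 <= t <= 1 ->
    continuous (fun z : U * R => f (fst z) (snd z)) (y, t)) -> ex_RInt (f y) 0 1).
{ intros y Hy; apply ex_RInt_01; intros t Ht.
  apply (continuous_comp_2 (fun _ => y) (fun t => t) f);
    [apply continuous_const|apply continuous_id|now apply Hy]. }
assert (Hu : locally x (fun y => forall t, 0 <= t <= 1 ->
           Rabs (f y t - f x t) < eps / 2)).
{ apply (locally_segment (fun z => Rabs (f (fst z) (snd z) - f x (snd z)) < eps / 2)).
  intros t Ht.
  assert (He' : 0 < eps / 4) by (destruct eps; simpl; lra).
  destruct (proj1 (filterlim_locally _ _) (loc_cont_continuous _ _ (H t Ht))
              (mkposreal _ He')) as [d Hd].
  exists d; intros [y s] [Hy Hs].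
  assert (E1 : Rabs (f y s - f x t) < eps / 4) by exact (Hd (y, s) (conj Hy Hs)).
  assert (E2 : Rabs (f x s - f x t) < eps / 4)
    by exact (Hd (x, s) (conj (ball_center x d) Hs)).
  simpl; apply Rabs_def2 in E1; apply Rabs_def2 in E2; apply Rabs_def1; lra. }
refine (filter_imp _ _ _ (filter_and _ _ Hc Hu)); intros y [Hcy Huy].
pose proof (Hi _ Hcy) as Iy.
pose proof (Hi _ (fun t Ht => loc_cont_continuous _ _ (H t Ht))) as Ix.
change (Rabs (RInt (f y) 0 1 - RInt (f x) 0 1) < eps).
replace (RInt (f y) 0 1 - RInt (f x) 0 1)
  with (RInt (fun t => f y t - f x t) 0 1)
  by apply (RInt_minus (V := R_CompleteNormedModule) _ _ _ _ Iy Ix).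
apply Rle_lt_trans with ((1 - 0) * (eps / 2)); [|lra].
apply abs_RInt_le_const; [lra| |].
- apply (ex_RInt_minus (V := R_NormedModule) _ _ _ _ Iy Ix).
- intros t Ht; left; now apply Huy.
Qed.

Lemma loc_cont_everywhere {U : UniformSpace} (f : U -> R) (x : U) :
  (forall y, continuous f y) -> loc_cont f x.
Proof. intros H; now apply (filter_forall (F := locally x)). Qed.

Lemma loc_cont_plus {U : UniformSpace} (f g : U -> R) (x : U) :
  loc_cont f x -> loc_cont g x -> loc_cont (fun y => f y + g y) x.
Proof.
intros Hf Hg; unfold loc_cont; refine (filter_imp _ _ _ (filter_and _ _ Hf Hg)); intros y [Cf Cg].
now apply (continuous_plus (V := R_NormedModule)).
Qed.

Lemma loc_cont_opp {U : UniformSpace} (f : U -> R) (x : U) :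
  loc_cont f x -> loc_cont (fun y => - f y) x.
Proof.
unfold loc_cont; apply filter_imp; intros y Cf; now apply (continuous_opp (V := R_NormedModule)).
Qed.

Lemma loc_cont_minus {U : UniformSpace} (f g : U -> R) (x : U) :
  loc_cont f x -> loc_cont g x -> loc_cont (fun y => f y - g y) x.
Proof.
intros Hf Hg; apply (loc_cont_plus f (fun y => - g y)); [easy|now apply loc_cont_opp].
Qed.

Lemma loc_cont_mult {U : UniformSpace} (f g : U -> R) (x : U) :
  loc_cont f x -> loc_cont g x -> loc_cont (fun y => f y * g y) x.
Proof.
intros Hf Hg; unfold loc_cont; refine (filter_imp _ _ _ (filter_and _ _ Hf Hg)); intros y [Cf Cg].
now apply (continuous_mult (K := R_AbsRing)).
Qed.

Lemma loc_cont_pow {U : UniformSpace} (f : U -> R) (n : nat) (x : U) :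
  loc_cont f x -> loc_cont (fun y => f y ^ n) x.
Proof.
intros Hf; induction n as [|n IH].
- apply loc_cont_everywhere; intros y; apply continuous_const.
- now apply (loc_cont_mult f (fun y => f y ^ n)).
Qed.

Lemma loc_cont_pos {U : UniformSpace} (f : U -> R) (x : U) :
  loc_cont f x -> 0 < f x -> locally x (fun y => 0 < f y).
Proof.
intros Hf Hx; apply loc_cont_continuous in Hf.
apply Hf; apply (open_gt 0 (f x) Hx).
Qed.

Lemma loc_cont_comp {U V : UniformSpace} (f : U -> V) (g : V -> R) (x : U) :
  locally x (fun y => continuous f y) -> loc_cont g (f x) ->
  loc_cont (fun y => g (f y)) x.
Proof.
intros Hf Hg.
pose proof (locally_singleton _ _ Hf _ Hg) as Hg'.
refine (filter_imp _ _ _ (filter_and _ _ Hf Hg')); intros y [Cf Cg].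
now apply continuous_comp.
Qed.

Lemma loc_cont_Rpower {U : UniformSpace} (f : U -> R) (c : R) (x : U) :
  loc_cont f x -> 0 < f x -> loc_cont (fun y => Rpower (f y) c) x.
Proof.
intros Hf Hx; unfold loc_cont; refine (filter_imp _ _ _ (filter_and _ _ Hf (loc_cont_pos _ _ Hf Hx))).
intros y [Cf Hy]; apply (continuous_comp f (fun t => Rpower t c)); [easy|].
apply ex_derive_continuous_R; eexists; now apply is_derive_Rpower.
Qed.

Lemma loc_cont_inv {U : UniformSpace} (f : U -> R) (x : U) :
  loc_cont f x -> 0 < f x -> loc_cont (fun y => / f y) x.
Proof.
intros Hf Hx; unfold loc_cont; refine (filter_imp _ _ _ (filter_and _ _ Hf (loc_cont_pos _ _ Hf Hx))).
intros y [Cf Hy]; apply (continuous_comp f Rinv); [easy|].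
apply continuous_Rinv; lra.
Qed.

Lemma loc_cont_pair {U : UniformSpace} (f g : U -> R) (h : R -> R -> R) (x : U) :
  loc_cont f x -> loc_cont g x ->
  loc_cont (fun z : R * R => h (fst z) (snd z)) (f x, g x) ->
  loc_cont (fun y => h (f y) (g y)) x.
Proof.
intros Hf Hg Hh.
apply (loc_cont_comp (fun y => (f y, g y)) (fun z : R * R => h (fst z) (snd z))); [|easy].
refine (filter_imp _ _ _ (filter_and _ _ Hf Hg)); intros y [Cf Cg].
apply (continuous_comp_2 f g pair); [easy|easy|].
apply (continuous_ext (fun z => z)); [now intros []|apply continuous_id].
Qed.

(** * The hypergeometric functions as integrals over a square *)

Ltac solve_projection :=
  first [ apply continuous_id | apply continuous_fst | apply continuous_snd
        | match goal with
          | |- continuous (fun z => fst (@?f z)) _ =>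
              apply (continuous_comp f fst); [solve_projection|apply continuous_fst]
          | |- continuous (fun z => snd (@?f z)) _ =>
              apply (continuous_comp f snd); [solve_projection|apply continuous_snd]
          end ].

(** Proves local continuity of an expression built from coordinates by field
    operations and powers, leaving the positivity of inverted and exponentiated
    subterms. *)
Ltac solve_loc_cont :=
  cbv beta;
  lazymatch goal with
  | |- loc_cont (fun _ => ?c) _ => apply loc_cont_everywhere; intro; apply continuous_const
  | |- loc_cont (fun z => @?f z + @?g z) _ => apply (loc_cont_plus f g); solve_loc_cont
  | |- loc_cont (fun z => @?f z - @?g z) _ => apply (loc_cont_minus f g); solve_loc_cont
  | |- loc_cont (fun z => @?f z * @?g z) _ => apply (loc_cont_mult f g); solve_loc_cont
  | |- loc_cont (fun z => - @?f z) _ => apply (loc_cont_opp f); solve_loc_cont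
  | |- loc_cont (fun z => / @?f z) _ => apply (loc_cont_inv f); [solve_loc_cont|]
  | |- loc_cont (fun z => @?f z ^ ?n) _ => apply (loc_cont_pow f n); solve_loc_cont
  | |- loc_cont (fun z => Rpower (@?f z) ?c) _ =>
      apply (loc_cont_Rpower f c); [solve_loc_cont|]
  | |- _ => try (apply loc_cont_everywhere; intro; solve_projection)
  end.

Lemma convex_pos (a b t : R) : 0 < a -> 0 < b -> 0 <= t <= 1 -> 0 < (1 - t) * a + t * b.
Proof. intros Ha Hb Ht; destruct (Req_dec t 0) as [->|]; nra. Qed.

(** The barycentre of 1, s, w with weights [(1-p)(1-r)], [(1-p) r], [p], that is,
    the linear form [1 - xp - yq] of Appell's integral for [x = 1 - w], [y = 1 - s],
    [q = (1 - p) r]. *)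
Definition barycentre (s w p r : R) : R := (1 - p) * ((1 - r) * 1 + r * s) + p * w.

Lemma barycentre_pos (s w p r : R) :
  0 < s -> 0 < w -> 0 <= p <= 1 -> 0 <= r <= 1 -> 0 < barycentre s w p r.
Proof.
intros; unfold barycentre; apply convex_pos; try easy; apply convex_pos; lra.
Qed.

Lemma hyp2F1_segment (c : R) (n : nat) (s : R) :
  0 < s ->
  hyp2F1 c 1 (INR n + 2) (1 - s) =
  (INR n + 1) *
  RInt (fun t => (1 - t) ^ n * Rpower ((1 - t) * 1 + t * s) (- c)) 0 1.
Proof.
intros Hs; unfold hyp2F1.
replace (INR n + 2) with (INR (S n) + 1) by (rewrite S_INR; ring).
replace (INR (S n) + 1 - 1) with (INR n + 1) by (rewrite S_INR; ring).
rewrite Gamma_1, !Gamma_fact; f_equal.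
- change (fact (S n)) with (S n * fact n)%nat; rewrite mult_INR, S_INR.
  field; apply INR_fact_neq_0.
- apply RInt_gen_open; [lra| |].
  + intros t Ht.
    replace (1 - 1) with 0 by ring; replace (INR n + 1 - 1) with (INR n) by ring.
    rewrite Rpower_O, Rpower_pow, Rmult_1_l by lra.
    do 2 f_equal; ring.
  + intros t Ht; apply loc_cont_continuous.
    solve_loc_cont; apply convex_pos; lra.
Qed.

(** The substitution [q = (1 - p) r] turns the simplex into the unit square; it
    brings in the Jacobian [1 - p] and one more factor [1 - p] for each factor q
    or [1 - p - q], whence the exponent [k + l + 1]. *)
Lemma appellF1_square (c : R) (k l : nat) (s w : R) :
  0 < s -> 0 < w ->
  appellF1 c 1 (INR l + 1) (INR k + INR l + 3) (1 - w) (1 - s) =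
  INR (fact (k + l + 2)) / (INR (fact l) * INR (fact k)) *
  RInt (fun p => RInt (fun r =>
    (1 - p) ^ (k + l + 1) * (r ^ l * (1 - r) ^ k) * Rpower (barycentre s w p r) (- c))
    0 1) 0 1.
Proof.
intros Hs Hw; unfold appellF1.
replace (INR k + INR l + 3 - 1 - (INR l + 1)) with (INR k + 1) by ring.
replace (INR k + INR l + 3) with (INR (k + l + 2) + 1)
  by (rewrite !plus_INR; simpl; ring).
rewrite Gamma_1, !Gamma_fact; f_equal.
{ field; split; apply INR_fact_neq_0. }
apply RInt_gen_open; [lra| |].
- intros p Hp.
  rewrite (RInt_gen_open _ (fun q => q ^ l * (1 - p - q) ^ k *
             Rpower ((1 - p) - q + q * s + p * w) (- c))); [|lra| |].
  + pose proof (RInt_comp_lin (V := R_CompleteNormedModule)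
      (fun q => q ^ l * (1 - p - q) ^ k *
             Rpower ((1 - p) - q + q * s + p * w) (- c)) (1 - p) 0 0 1) as E.
    rewrite Rmult_0_r, Rmult_1_r, !Rplus_0_r in E.
    rewrite <- E.
    * apply (RInt_ext (V := R_CompleteNormedModule)); intros r _.
      unfold scal; simpl; unfold mult; simpl.
      replace ((1 - p) * r + 0) with ((1 - p) * r) by ring.
      replace (1 - p - (1 - p) * r) with ((1 - p) * (1 - r)) by ring.
      rewrite !Rpow_mult_distr, !pow_add, pow_1.
      replace ((1 - p) * (1 - r) + (1 - p) * r * s + p * w) with (barycentre s w p r)
        by (unfold barycentre; ring).
      ring.
    * apply (ex_RInt_continuous (V := R_CompleteNormedModule)); intros q.
      rewrite Rmin_left, Rmax_right by lra; intros Hq.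
      apply loc_cont_continuous; solve_loc_cont; nra.
  + intros q Hq.
    replace (1 - 1) with 0 by ring; replace (INR l + 1 - 1) with (INR l) by ring.
    replace (INR k + 1 - 1) with (INR k) by ring.
    rewrite Rpower_O, !Rpower_pow, Rmult_1_l by lra.
    do 2 f_equal; ring.
  + intros q Hq; apply loc_cont_continuous; solve_loc_cont; nra.
- intros p Hp; apply loc_cont_continuous, loc_cont_RInt; intros r Hr.
  unfold barycentre; solve_loc_cont; now apply barycentre_pos.
Qed.

(** * Integral formulas for K and H *)

Definition loc_cont_square (f : R -> R -> R) : Prop :=
  forall p r, 0 <= p <= 1 -> 0 <= r <= 1 ->
  loc_cont (fun z : R * R => f (fst z) (snd z)) (p, r).

Lemma ex_RInt_square (f : R -> R -> R) :
  loc_cont_square f ->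
  (forall p, 0 <= p <= 1 -> ex_RInt (f p) 0 1) /\ ex_RInt (fun p => RInt (f p) 0 1) 0 1.
Proof.
intros Hf; split.
- intros p Hp; apply ex_RInt_01; intros r Hr.
  apply (continuous_comp_2 (fun _ => p) (fun r => r) f);
    [apply continuous_const|apply continuous_id|].
  apply loc_cont_continuous, Hf; easy.
- apply ex_RInt_01; intros p Hp; apply loc_cont_continuous, loc_cont_RInt.
  intros r Hr; now apply Hf.
Qed.

Lemma RInt_square_lin (f g : R -> R -> R) (c d : R) :
  loc_cont_square f -> loc_cont_square g ->
  RInt (fun p => RInt (fun r => c * f p r + d * g p r) 0 1) 0 1 =
  c * RInt (fun p => RInt (f p) 0 1) 0 1 + d * RInt (fun p => RInt (g p) 0 1) 0 1.
Proof.
intros Hf Hg; destruct (ex_RInt_square f Hf) as [F1 F2], (ex_RInt_square g Hg) as [G1 G2].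
rewrite <- RInt_lin by easy.
apply (RInt_ext (V := R_CompleteNormedModule)); intros p.
rewrite Rmin_left, Rmax_right by lra; intros Hp.
apply RInt_lin; [apply F1|apply G1]; lra.
Qed.

(** Up to the factor [1 - t], the derivative in s of [s L^(-a-1)]. *)
Definition K_integrand (a s t : R) : R :=
  let L := (1 - t) * 1 + t * s in
  (1 - t) * (L - (a + 1) * (s * t)) * Rpower L (- a - 2).

(** The two Gauss functions merge because [s t = L - (1 - t)]: this is Euler's
    identity for the homogeneous function [L^(-a-1)] of its two nodes. *)
Lemma K_Dk_integral (a s : R) :
  0 < a -> 0 < s ->
  K_Dk s (2 * a) = Gamma (a + 1) / a * RInt (K_integrand a s) 0 1.
Proof.
intros Ha Hs; unfold K_Dk.
replace (2 * a / 2) with a by field.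
pose proof (hyp2F1_segment (a + 1) 1 s Hs) as E1.
pose proof (hyp2F1_segment (a + 2) 2 s Hs) as E2.
replace (INR 1 + 2) with 3 in E1 by (simpl; ring).
replace (INR 2 + 2) with 4 in E2 by (simpl; ring).
rewrite E1, E2.
replace (a + 2) with (a + 1 + 1) by ring; rewrite (Gamma_succ (a + 1)) by lra.
replace (a + 1 + 1) with (a + 2) by ring.
rewrite (RInt_ext (V := R_CompleteNormedModule) (K_integrand a s)
  (fun t => - a * ((1 - t) ^ 1 * Rpower ((1 - t) * 1 + t * s) (- (a + 1)))
            + (a + 1) * ((1 - t) ^ 2 * Rpower ((1 - t) * 1 + t * s) (- (a + 2))))).
- rewrite RInt_lin.
  + simpl INR; field; lra.
  + apply ex_RInt_01; intros t Ht; apply loc_cont_continuous; solve_loc_cont.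
    apply convex_pos; lra.
  + apply ex_RInt_01; intros t Ht; apply loc_cont_continuous; solve_loc_cont.
    apply convex_pos; lra.
- intros t; rewrite Rmin_left, Rmax_right by lra; intros Ht.
  unfold K_integrand; cbv zeta; set (L := (1 - t) * 1 + t * s).
  replace (- (a + 1)) with (- a - 2 + 1) by ring.
  replace (- (a + 2)) with (- a - 2) by ring.
  rewrite Rpower_plus, Rpower_1 by (apply convex_pos; lra).
  replace (s * t) with (L - (1 - t)) by (unfold L; ring); simpl; ring.
Qed.

(** With [L] the barycentre, this is [(1-p)^2 (1-r)] times the derivative in w of
    [w L^(-a-2)]. *)
Definition H_integrand (a s w p r : R) : R :=
  let L := barycentre s w p r in
  (1 - p) ^ 2 * (1 - r) * (L - (a + 2) * (w * p)) * Rpower L (- a - 3).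

(** The three Appell functions merge in the same way: their nodes 1 and s enter
    through [(1-p)(1-r) + (1-p) r s], which is [L - w p]. *)
Lemma H_Dk_integral (a s t : R) :
  0 < a -> 0 < s -> 0 < t ->
  H_Dk s t (2 * a) =
  - (2 * Gamma (a + 2) / a) *
  RInt (fun p => RInt (H_integrand a s (s * t) p) 0 1) 0 1.
Proof.
intros Ha Hs Ht; unfold H_Dk.
assert (Hw : 0 < s * t) by nra; set (w := s * t) in *.
replace (2 * a / 2) with a by field.
pose proof (appellF1_square (a + 2) 1 0 s w Hs Hw) as E1.
pose proof (appellF1_square (a + 3) 2 0 s w Hs Hw) as E2.
pose proof (appellF1_square (a + 3) 1 1 s w Hs Hw) as E3.
replace (INR 0 + 1) with 1 in * by (simpl; ring).
replace (INR 1 + 1) with 2 in * by (simpl; ring).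
replace (INR 1 + INR 0 + 3) with 4 in * by (simpl; ring).
replace (INR 2 + INR 0 + 3) with 5 in * by (simpl; ring).
replace (INR 1 + INR 1 + 3) with 5 in * by (simpl; ring).
rewrite E1, E2, E3; clear E1 E2 E3.
replace (Gamma (a + 3)) with ((a + 2) * Gamma (a + 2))
  by (rewrite <- Gamma_succ by lra; f_equal; ring).
assert (Hc : forall k l m c, loc_cont_square (fun p r =>
    (1 - p) ^ m * (r ^ l * (1 - r) ^ k) * Rpower (barycentre s w p r) c)).
{ intros k l m c p r Hp Hr; unfold barycentre; solve_loc_cont; now apply barycentre_pos. }
set (f1 := fun p r =>
  (1 - p) ^ (1 + 0 + 1) * (r ^ 0 * (1 - r) ^ 1) * Rpower (barycentre s w p r) (- (a + 2))).
set (f2 := fun p r =>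
  (1 - p) ^ (2 + 0 + 1) * (r ^ 0 * (1 - r) ^ 2) * Rpower (barycentre s w p r) (- (a + 3))).
set (f3 := fun p r =>
  (1 - p) ^ (1 + 1 + 1) * (r ^ 1 * (1 - r) ^ 1) * Rpower (barycentre s w p r) (- (a + 3))).
rewrite (RInt_ext (V := R_CompleteNormedModule)
  (fun p => RInt (H_integrand a s w p) 0 1)
  (fun p => RInt (fun r => - (a + 1) * f1 p r
                    + (a + 2) * (1 * f2 p r + s * f3 p r)) 0 1)).
- rewrite (RInt_square_lin f1 (fun p r => 1 * f2 p r + s * f3 p r)), RInt_square_lin.
  + unfold f1, f2, f3; simpl fact; simpl INR; field; lra.
  + apply Hc.
  + apply Hc.
  + apply Hc.
  + intros p r Hp Hr.
    apply (loc_cont_plus (fun z : R * R => 1 * f2 (fst z) (snd z))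
             (fun z => s * f3 (fst z) (snd z)));
      (apply loc_cont_mult; [solve_loc_cont|]); apply Hc; easy.
- intros p; rewrite Rmin_left, Rmax_right by lra; intros Hp.
  apply (RInt_ext (V := R_CompleteNormedModule)); intros r.
  rewrite Rmin_left, Rmax_right by lra; intros Hr.
  unfold f1, f2, f3, H_integrand; cbv zeta.
  replace (- (a + 2)) with (- a - 3 + 1) by ring.
  replace (- (a + 3)) with (- a - 3) by ring.
  rewrite Rpower_plus, Rpower_1 by (apply barycentre_pos; lra).
  unfold barycentre; simpl; ring.
Qed.

(** * Closed forms away from the coinciding nodes *)

(** Equalities between integrals are typed in the carrier of a normed module;
    [ring] and [field] need to see the type of reals. *)
Ltac real_eq := lazymatch goal with |- @eq _ ?x ?y => change (@eq R x y) end.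

Lemma Rpower_pred2 (x c : R) : 0 < x -> Rpower x (c - 2) = Rpower x c / x ^ 2.
Proof.
intros Hx; replace (c - 2) with (c - 1 - 1) by ring.
rewrite !Rpower_pred by easy; field; lra.
Qed.

Lemma Rpower_pred3 (x c : R) : 0 < x -> Rpower x (c - 3) = Rpower x c / x ^ 3.
Proof.
intros Hx; replace (c - 3) with (c - 2 - 1) by ring.
rewrite Rpower_pred, Rpower_pred2 by easy; field; lra.
Qed.

(** The derivative in w of [w L^(-a)] for the two nodes s and w: its integral is
    [d/dw (w f[s,w])] up to the factor [1 - a]. *)
Definition Q_integrand (a s w p : R) : R :=
  let L := (1 - p) * s + p * w in (L - a * (w * p)) * Rpower L (- a - 1).

Lemma continuous_Q_integrand (a s w p : R) :
  0 < s -> 0 < w -> 0 <= p <= 1 -> continuous (Q_integrand a s w) p.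
Proof.
intros Hs Hw Hp; apply loc_cont_continuous; unfold Q_integrand; cbv zeta.
solve_loc_cont; now apply convex_pos.
Qed.

Lemma continuous_K_integrand (a s p : R) :
  0 < s -> 0 <= p <= 1 -> continuous (K_integrand a s) p.
Proof.
intros Hs Hp; apply loc_cont_continuous; unfold K_integrand; cbv zeta.
solve_loc_cont; apply convex_pos; lra.
Qed.

(** With [y = 1 - s] and [h = 1 - p], the barycentre is [L = A - h y r], where
    [A = h + p w].  If [psi = Psi''], then [h^2 y^2 (1 - r) psi(L)] is the r-derivative of
    [Psi(L) - h y (1 - r) Psi'(L)].  The endpoints [r = 0] and [r = 1] replace the
    nodes (1, s) by 1 and by s, which gives the integrands of Q and K.  No division
    by h occurs, so [p = 1] needs no separate treatment. *)
Lemma H_inner_integral (a s w p : R) :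
  0 < a -> 0 < s -> s <> 1 -> 0 < w -> 0 <= p <= 1 ->
  RInt (H_integrand a s w p) 0 1 =
  (Q_integrand a s w p - Q_integrand a 1 w p) / (a * (a + 1) * (1 - s) ^ 2)
  - K_integrand a w p / ((a + 1) * (1 - s)).
Proof.
intros Ha Hs Hs1 Hw Hp.
assert (Hy : 1 - s <> 0) by lra.
rewrite (RInt_primitive (fun r =>
  Rpower (barycentre s w p r) (- a) *
  ((1 - a * (w * p) / barycentre s w p r) / a
   + (1 - p) * (1 - s) * (1 - r) *
     (/ barycentre s w p r - (a + 1) * (w * p) / barycentre s w p r ^ 2))
  / ((a + 1) * (1 - s) ^ 2))); [|lra| |].
- assert (L1 : barycentre s w p 1 = (1 - p) * s + p * w) by (unfold barycentre; ring).
  assert (L0 : barycentre s w p 0 = (1 - p) * 1 + p * w) by (unfold barycentre; ring).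
  assert (P1 : 0 < (1 - p) * s + p * w) by (apply convex_pos; lra).
  assert (P0 : 0 < (1 - p) * 1 + p * w) by (apply convex_pos; lra).
  rewrite L1, L0; unfold Q_integrand, K_integrand; cbv zeta.
  rewrite !Rpower_pred, !Rpower_pred2 by easy.
  real_eq; field; repeat split; lra.
- intros r Hr.
  pose proof (barycentre_pos s w p r Hs Hw Hp Hr) as HL.
  unfold H_integrand; cbv zeta; rewrite Rpower_pred3 by easy.
  unfold barycentre, Rpower in *; auto_derive; [repeat split; try easy; nra|].
  change (1 + - r) with (1 - r); field; repeat split; try lra.
- intros r Hr; apply loc_cont_continuous; unfold H_integrand, barycentre; cbv zeta.
  solve_loc_cont; now apply barycentre_pos.
Qed.

(** The recursion
    [f[1,1,s,w] = (f[s,w] - f[1,w]) / (1-s)^2 + f[1,1,w] / (1-s)], after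
    [d/dw (w .)], in integral form.  It holds for every w, in particular at [w = 1],
    which is the case that T needs. *)
Lemma H_Dk_reduction (a s t : R) :
  0 < a -> 0 < s -> s <> 1 -> 0 < t ->
  H_Dk s t (2 * a) =
  2 * K_Dk (s * t) (2 * a) / (1 - s)
  - 2 * Gamma (a + 1) / (a ^ 2 * (1 - s) ^ 2) *
    (RInt (Q_integrand a s (s * t)) 0 1 - RInt (Q_integrand a 1 (s * t)) 0 1).
Proof.
intros Ha Hs Hs1 Ht; assert (Hw : 0 < s * t) by nra.
rewrite H_Dk_integral, K_Dk_integral by easy; set (w := s * t) in *.
replace (Gamma (a + 2)) with ((a + 1) * Gamma (a + 1))
  by (rewrite <- Gamma_succ by lra; f_equal; ring).
assert (Iq : forall x, 0 < x -> ex_RInt (Q_integrand a x w) 0 1)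
  by (intros; apply ex_RInt_01; intros; now apply continuous_Q_integrand).
assert (Ik : ex_RInt (K_integrand a w) 0 1)
  by (apply ex_RInt_01; intros; now apply continuous_K_integrand).
assert (Iqq : ex_RInt (fun p => 1 * Q_integrand a s w p + -1 * Q_integrand a 1 w p) 0 1).
{ apply ex_RInt_01; intros p Hp; apply (continuous_plus (V := R_NormedModule));
    apply (continuous_scal_r (V := R_NormedModule)); apply continuous_Q_integrand; lra. }
rewrite (RInt_ext (V := R_CompleteNormedModule)
  (fun p => RInt (H_integrand a s w p) 0 1)
  (fun p => / (a * (a + 1) * (1 - s) ^ 2)
              * (1 * Q_integrand a s w p + -1 * Q_integrand a 1 w p)
            + (- / ((a + 1) * (1 - s))) * K_integrand a w p)).
- rewrite (RInt_lin _ (K_integrand a w)) by easy.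
  rewrite (RInt_lin (Q_integrand a s w)) by (apply Iq; lra).
  real_eq; field; repeat split; lra.
- intros p; rewrite Rmin_left, Rmax_right by lra; intros Hp.
  rewrite H_inner_integral by lra.
  real_eq; field; repeat split; lra.
Qed.

(** In the primitives of [Q_value] and [K_Dk_value] the integration variable is
    eliminated in favour of L, for instance [p = (L - s) / (w - s)], which leaves
    sums of powers of L. *)
Lemma Q_value (a s w : R) :
  1 < a -> 0 < s -> 0 < w -> s <> w ->
  RInt (Q_integrand a s w) 0 1 =
  ((a - 1) * w ^ 2 * Rpower w (- a) - (a - 2) * w * s * Rpower w (- a)
   - s ^ 2 * Rpower s (- a)) / ((a - 1) * (w - s) ^ 2).
Proof.
intros Ha Hs Hw Hsw; assert (Hd : w - s <> 0) by lra.
rewrite (RInt_primitive (fun p =>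
  let L := (1 - p) * s + p * w in
  Rpower L (- a) * ((1 - a * w / (w - s)) * L / (1 - a) - w * s / (w - s)) / (w - s)));
  [|lra| |].
- cbv zeta.
  replace ((1 - 1) * s + 1 * w) with w by ring.
  replace ((1 - 0) * s + 0 * w) with s by ring.
  real_eq; field; repeat split; lra.
- intros p Hp; pose proof (convex_pos s w p Hs Hw Hp) as HL.
  unfold Q_integrand; cbv zeta; rewrite Rpower_pred by easy.
  unfold Rpower in *; auto_derive; [easy|].
  change (1 + - p) with (1 - p); field; repeat split; lra.
- intros p Hp; now apply continuous_Q_integrand.
Qed.

Lemma Q_value_1 (a : R) : RInt (Q_integrand a 1 1) 0 1 = 1 - a / 2.
Proof.
rewrite (RInt_primitive (fun p => p - a * p ^ 2 / 2)); [real_eq; field|lra| |].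
- intros p Hp; unfold Q_integrand; cbv zeta.
  replace ((1 - p) * 1 + p * 1) with 1 by ring.
  unfold Rpower; rewrite ln_1, Rmult_0_r, exp_0; auto_derive; [easy|field].
- intros p Hp; apply continuous_Q_integrand; lra.
Qed.

Lemma K_Dk_value (a s : R) :
  1 < a -> 0 < s -> s <> 1 ->
  K_Dk s (2 * a) =
  Gamma (a + 1) * ((2 - a) * s + a - Rpower s (- a) * (a * s ^ 2 + (2 - a) * s))
  / (a ^ 2 * (a - 1) * (s - 1) ^ 3).
Proof.
intros Ha Hs Hs1; assert (Hd : s - 1 <> 0) by lra.
rewrite K_Dk_integral by lra.
rewrite (RInt_primitive (fun t =>
  let L := (1 - t) * 1 + t * s in
  let f := (a + 1) * s in
  let e := s - 1 - f in
  Rpower L (- a) * (e * L / (a - 1) - (s * e - f) / a - s * f / ((a + 1) * L))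
  / (s - 1) ^ 3)); [|lra| |].
- cbv zeta.
  replace ((1 - 1) * 1 + 1 * s) with s by ring.
  replace ((1 - 0) * 1 + 0 * s) with 1 by ring.
  replace (Rpower 1 (- a)) with 1
    by (unfold Rpower; rewrite ln_1, Rmult_0_r, exp_0; easy).
  field; repeat split; lra.
- intros p Hp; pose proof (convex_pos 1 s p Rlt_0_1 Hs Hp) as HL.
  unfold K_integrand; cbv zeta; rewrite Rpower_pred2 by easy.
  unfold Rpower in *; auto_derive; [repeat split; try easy; nra|].
  change (1 + - p) with (1 - p); field; repeat split; lra.
- intros p Hp; apply continuous_K_integrand; lra.
Qed.

Lemma K_Dk_value_1 (a : R) :
  0 < a -> K_Dk 1 (2 * a) = Gamma (a + 1) * (2 - a) / (6 * a).
Proof.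
intros Ha; rewrite K_Dk_integral by lra.
rewrite (RInt_primitive (fun t => t - (a + 2) * t ^ 2 / 2 + (a + 1) * t ^ 3 / 3));
  [real_eq; field; lra|lra| |].
- intros t Ht; unfold K_integrand; cbv zeta.
  replace ((1 - t) * 1 + t * 1) with 1 by ring.
  unfold Rpower; rewrite ln_1, Rmult_0_r, exp_0; auto_derive; [easy|field].
- intros t Ht; apply continuous_K_integrand; lra.
Qed.

(** * Slope functions *)

Lemma loc_cont_ext_loc {U : UniformSpace} (f g : U -> R) (x : U) :
  locally x (fun y => f y = g y) -> loc_cont f x -> loc_cont g x.
Proof.
intros He Hf; unfold loc_cont in *.
refine (filter_imp _ _ _ (filter_and _ _ Hf (locally_locally _ _ He))).
intros y [Cf E]; now apply (continuous_ext_loc g f).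
Qed.

(** Caratheodory's form of continuous differentiability on the positive half-line,
    but with continuity in both variables jointly.  It passes through integrals
    without differentiation under the integral sign, and [D x y] with two moving
    arguments is exactly what the extended quotients in (u, v) require. *)
Definition has_slope (f : R -> R) (D : R -> R -> R) : Prop :=
  (forall x y, 0 < x -> 0 < y -> f x - f y = D x y * (x - y)) /\
  (forall x y, 0 < x -> 0 < y ->
     loc_cont (fun z : R * R => D (fst z) (snd z)) (x, y)).

Lemma has_slope_ext (f g : R -> R) (D : R -> R -> R) :
  (forall x, 0 < x -> f x = g x) -> has_slope f D -> has_slope g D.
Proof.
intros E [H1 H2]; split; [|easy].
intros x y Hx Hy; rewrite <- !E by easy; now apply H1.
Qed.

Lemma has_slope_loc_cont (f : R -> R) (D : R -> R -> R) (x : R) :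
  has_slope f D -> 0 < x -> loc_cont f x.
Proof.
intros [H1 H2] Hx.
apply (loc_cont_ext_loc (fun y => f 1 + D y 1 * (y - 1))).
- assert (Hid : loc_cont (fun y : R => y) x) by solve_loc_cont.
  refine (filter_imp _ _ _ (loc_cont_pos _ _ Hid Hx)); intros y Hy.
  rewrite <- H1; lra.
- apply loc_cont_plus; [solve_loc_cont|].
  apply loc_cont_mult; [|solve_loc_cont].
  apply (loc_cont_pair (fun y => y) (fun _ => 1) D); [solve_loc_cont|solve_loc_cont|].
  apply H2; lra.
Qed.

Lemma has_slope_lin (f g : R -> R) (D E : R -> R -> R) (c d : R) :
  has_slope f D -> has_slope g E ->
  has_slope (fun x => c * f x + d * g x) (fun x y => c * D x y + d * E x y).
Proof.
intros [F1 F2] [G1 G2]; split; intros x y Hx Hy.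
- specialize (F1 x y Hx Hy); specialize (G1 x y Hx Hy).
  transitivity (c * (f x - f y) + d * (g x - g y)); [ring|rewrite F1, G1; ring].
- apply loc_cont_plus; (apply loc_cont_mult; [solve_loc_cont|]); auto.
Qed.

Lemma has_slope_RInt (f : R -> R -> R) (D : R -> R -> R -> R) :
  (forall x t, 0 < x -> 0 <= t <= 1 ->
     loc_cont (fun z : R * R => f (fst z) (snd z)) (x, t)) ->
  (forall x y t, 0 < x -> 0 < y -> 0 <= t <= 1 -> f x t - f y t = D x y t * (x - y)) ->
  (forall x y t, 0 < x -> 0 < y -> 0 <= t <= 1 ->
     loc_cont (fun z : R * R * R => D (fst (fst z)) (snd (fst z)) (snd z)) (x, y, t)) ->
  has_slope (fun x => RInt (f x) 0 1) (fun x y => RInt (D x y) 0 1).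
Proof.
intros Hf HD CD; split; intros x y Hx Hy.
- assert (If : forall x, 0 < x -> ex_RInt (f x) 0 1).
  { intros x' Hx'; apply ex_RInt_01; intros t Ht.
    apply (continuous_comp_2 (fun _ => x') (fun t => t) f);
      [apply continuous_const|apply continuous_id|].
    now apply loc_cont_continuous, Hf. }
  assert (ID : ex_RInt (D x y) 0 1).
  { apply ex_RInt_01; intros t Ht.
    apply (continuous_comp_2 (fun _ => (x, y)) (fun t => t)
             (fun q t => D (fst q) (snd q) t));
      [apply continuous_const|apply continuous_id|].
    now apply loc_cont_continuous, (CD x y t). }
  real_eq; transitivity (1 * RInt (f x) 0 1 + -1 * RInt (f y) 0 1); [ring|].
  real_eq; transitivity ((x - y) * RInt (D x y) 0 1 + 0 * RInt (D x y) 0 1); [|ring].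
  rewrite <- !RInt_lin by auto.
  apply (RInt_ext (V := R_CompleteNormedModule)); intros t.
  rewrite Rmin_left, Rmax_right by lra; intros Ht.
  real_eq; transitivity (f x t - f y t); [ring|rewrite HD by lra; ring].
- apply (loc_cont_RInt (fun q => D (fst q) (snd q))); intros t Ht; now apply CD.
Qed.

(** The derivative averaged over the segment from y to x. *)
Definition pow_slope (c x y : R) : R :=
  RInt (fun t => c * Rpower ((1 - t) * y + t * x) (c - 1)) 0 1.

Lemma has_slope_Rpower (c : R) : has_slope (fun x => Rpower x c) (pow_slope c).
Proof.
assert (C : forall x y t, 0 < x -> 0 < y -> 0 <= t <= 1 ->
  loc_cont (fun z : R * R * R => c * Rpower
     ((1 - snd z) * snd (fst z) + snd z * fst (fst z)) (c - 1)) (x, y, t)).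
{ intros; solve_loc_cont; simpl; now apply convex_pos. }
split; intros x y Hx Hy.
- assert (I : ex_RInt (fun t => c * Rpower ((1 - t) * y + t * x) (c - 1)) 0 1).
  { apply ex_RInt_01; intros t Ht; apply loc_cont_continuous.
    solve_loc_cont; now apply convex_pos. }
  real_eq; transitivity ((x - y) * pow_slope c x y + 0 * pow_slope c x y); [|ring].
  unfold pow_slope; rewrite <- RInt_lin by easy.
  symmetry; rewrite (RInt_primitive (fun t => Rpower ((1 - t) * y + t * x) c));
    [|lra| |].
  + do 2 f_equal; ring.
  + intros t Ht; pose proof (convex_pos y x t Hy Hx Ht) as HL.
    rewrite Rpower_pred by easy; unfold Rpower; auto_derive; [easy|].
    change (1 + - t) with (1 - t); field; lra.
  + intros t Ht; apply loc_cont_continuous; solve_loc_cont; now apply convex_pos.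
- apply (loc_cont_RInt (fun q t => c * Rpower ((1 - t) * snd q + t * fst q) (c - 1))).
  intros t Ht; now apply C.
Qed.

(** Supplies the slopes of [x^j T(1/x)] in the second and fourth sums. *)
Lemma has_slope_inversion (c : R) (f : R -> R) (D : R -> R -> R) :
  has_slope f D ->
  has_slope (fun x => Rpower x c * f (/ x))
    (fun x y => pow_slope c x y * f (/ x) - Rpower y c * D (/ x) (/ y) * (/ x * / y)).
Proof.
intros Hf; destruct (has_slope_Rpower c) as [P1 P2]; split; intros x y Hx Hy.
- pose proof (Rinv_0_lt_compat _ Hx); pose proof (Rinv_0_lt_compat _ Hy).
  specialize (P1 x y Hx Hy); pose proof (proj1 Hf (/ x) (/ y) H H0) as F1.
  transitivity ((Rpower x c - Rpower y c) * f (/ x)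
                + Rpower y c * (f (/ x) - f (/ y))); [ring|].
  rewrite P1, F1; field; lra.
- pose proof (Rinv_0_lt_compat _ Hx); pose proof (Rinv_0_lt_compat _ Hy).
  assert (I1 : loc_cont (fun z : R * R => / fst z) (x, y)) by (solve_loc_cont; easy).
  assert (I2 : loc_cont (fun z : R * R => / snd z) (x, y)) by (solve_loc_cont; easy).
  apply loc_cont_minus; apply loc_cont_mult.
  + now apply P2.
  + apply (loc_cont_comp (fun z : R * R => / fst z) f); [easy|].
    now apply has_slope_loc_cont with D.
  + apply loc_cont_mult; [solve_loc_cont; easy|].
    apply (loc_cont_pair (fun z : R * R => / fst z) (fun z => / snd z) D); [easy|easy|].
    now apply Hf.
  + now apply loc_cont_mult.
Qed.

(** The first term of T is itself a slope, so a slope of it is needed: apply the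
    slope of powers under the integral that defines [pow_slope]. *)
Lemma has_slope_pow_slope (c : R) :
  exists D, has_slope (fun x => pow_slope c x 1) D.
Proof.
eexists; apply (has_slope_RInt
  (fun x t => c * Rpower ((1 - t) * 1 + t * x) (c - 1))
  (fun x y t =>
     c * pow_slope (c - 1) ((1 - t) * 1 + t * x) ((1 - t) * 1 + t * y) * t)).
- intros x t Hx Ht; solve_loc_cont; apply convex_pos; simpl; lra.
- intros x y t Hx Hy Ht.
  pose proof (proj1 (has_slope_Rpower (c - 1)) _ _ (convex_pos 1 x t Rlt_0_1 Hx Ht)
                (convex_pos 1 y t Rlt_0_1 Hy Ht)) as E; cbv beta in E.
  rewrite <- Rmult_minus_distr_l, E; ring.
- intros x y t Hx Hy Ht.
  apply loc_cont_mult; [|solve_loc_cont]; apply loc_cont_mult; [solve_loc_cont|].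
  apply (loc_cont_pair (fun z : R * R * R => (1 - snd z) * 1 + snd z * fst (fst z))
     (fun z => (1 - snd z) * 1 + snd z * snd (fst z)) (pow_slope (c - 1)));
    [solve_loc_cont|solve_loc_cont|].
  apply has_slope_Rpower; simpl; apply convex_pos; lra.
Qed.

(** The integral behind [H(x, 1/x)], where [w = 1].  The difference of two
    barycentres is [(1 - p) r (x - y)], so the slope of the integrand comes from
    slopes of the powers [L^(-a-2)] and [L^(-a-3)]. *)
Lemma has_slope_H_diagonal (a : R) :
  exists D, has_slope (fun x => RInt (fun p => RInt (H_integrand a x 1 p) 0 1) 0 1) D.
Proof.
set (E := fun x y p r =>
  (1 - p) ^ 2 * (1 - r) *
  (pow_slope (- a - 2) (barycentre x 1 p r) (barycentre y 1 p r)
   - (a + 2) * p * pow_slope (- a - 3) (barycentre x 1 p r) (barycentre y 1 p r)) *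
  ((1 - p) * r)).
assert (CE : forall x y p r, 0 < x -> 0 < y -> 0 <= p <= 1 -> 0 <= r <= 1 ->
  loc_cont (fun z : R * R * R * R => E (fst (fst (fst z))) (snd (fst (fst z)))
     (snd (fst z)) (snd z)) (x, y, p, r)).
{ intros x y p r Hx Hy Hp Hr.
  assert (CP : forall c, loc_cont (fun z : R * R * R * R => pow_slope c
     (barycentre (fst (fst (fst z))) 1 (snd (fst z)) (snd z))
     (barycentre (snd (fst (fst z))) 1 (snd (fst z)) (snd z))) (x, y, p, r)).
  { intros c.
    apply (loc_cont_pair
      (fun z : R * R * R * R => barycentre (fst (fst (fst z))) 1 (snd (fst z)) (snd z))
      (fun z => barycentre (snd (fst (fst z))) 1 (snd (fst z)) (snd z)) (pow_slope c));
      [unfold barycentre; solve_loc_cont|unfold barycentre; solve_loc_cont|].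
    apply has_slope_Rpower; simpl; apply barycentre_pos; lra. }
  unfold E; apply loc_cont_mult; [|solve_loc_cont].
  apply loc_cont_mult; [solve_loc_cont|].
  apply loc_cont_minus; [apply CP|apply loc_cont_mult; [solve_loc_cont|apply CP]]. }
assert (CH : forall x p r, 0 < x -> 0 <= p <= 1 -> 0 <= r <= 1 ->
  loc_cont (fun z : R * R * R => H_integrand a (fst (fst z)) 1 (snd (fst z)) (snd z))
    (x, p, r)).
{ intros x p r Hx Hp Hr; unfold H_integrand, barycentre; solve_loc_cont.
  simpl; apply barycentre_pos; lra. }
exists (fun x y => RInt (fun p => RInt (E x y p) 0 1) 0 1).
apply (has_slope_RInt (fun x p => RInt (H_integrand a x 1 p) 0 1)
         (fun x y p => RInt (E x y p) 0 1)).
- intros x p Hx Hp.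
  apply (loc_cont_RInt (fun q => H_integrand a (fst q) 1 (snd q))).
  intros r Hr; now apply CH.
- intros x y p Hx Hy Hp.
  assert (IH : forall x, 0 < x -> ex_RInt (H_integrand a x 1 p) 0 1).
  { intros x' Hx'; apply ex_RInt_01; intros r Hr.
    apply (continuous_comp_2 (fun _ => (x', p)) (fun r => r)
             (fun q r => H_integrand a (fst q) 1 (snd q) r));
      [apply continuous_const|apply continuous_id|].
    now apply loc_cont_continuous, CH. }
  assert (IE : ex_RInt (E x y p) 0 1).
  { apply ex_RInt_01; intros r Hr.
    apply (continuous_comp_2 (fun _ => (x, y, p)) (fun r => r)
             (fun q r => E (fst (fst q)) (snd (fst q)) (snd q) r));
      [apply continuous_const|apply continuous_id|].
    now apply loc_cont_continuous, (CE x y p r). }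
  real_eq; transitivity (1 * RInt (H_integrand a x 1 p) 0 1
                + -1 * RInt (H_integrand a y 1 p) 0 1); [ring|].
  real_eq; transitivity ((x - y) * RInt (E x y p) 0 1 + 0 * RInt (E x y p) 0 1); [|ring].
  rewrite <- !RInt_lin by auto.
  apply (RInt_ext (V := R_CompleteNormedModule)); intros r.
  rewrite Rmin_left, Rmax_right by lra; intros Hr.
  assert (Bx : 0 < barycentre x 1 p r) by (apply barycentre_pos; lra).
  assert (By : 0 < barycentre y 1 p r) by (apply barycentre_pos; lra).
  pose proof (proj1 (has_slope_Rpower (- a - 2)) _ _ Bx By) as E2.
  pose proof (proj1 (has_slope_Rpower (- a - 3)) _ _ Bx By) as E3.
  cbv beta in E2, E3.
  replace (barycentre x 1 p r - barycentre y 1 p r) with ((1 - p) * r * (x - y)) in E2, E3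
    by (unfold barycentre; ring).
  real_eq; transitivity ((1 - p) ^ 2 * (1 - r) *
    ((Rpower (barycentre x 1 p r) (- a - 2) - Rpower (barycentre y 1 p r) (- a - 2))
     - (a + 2) * p *
       (Rpower (barycentre x 1 p r) (- a - 3) - Rpower (barycentre y 1 p r) (- a - 3)))).
  + unfold H_integrand; cbv zeta.
    replace (- a - 2) with (- a - 3 + 1) by ring.
    rewrite !(Rpower_plus _ 1), !Rpower_1 by easy; ring.
  + rewrite E2, E3; unfold E; ring.
- intros x y p Hx Hy Hp.
  apply (loc_cont_RInt (fun q => E (fst (fst q)) (snd (fst q)) (snd q))).
  intros r Hr; now apply CE.
Qed.

(** * Extended quotients *)

Lemma quot_eq {U : UniformSpace} (N D E : U -> R) (p : U) :
  locally p (fun q => N q = E q * D q) -> continuous E p ->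
  (D p = 0 -> forall P, locally p P -> exists q, P q /\ D q <> 0) ->
  quot N D p = E p.
Proof.
intros HN HE Hd; destruct (Req_dec (D p) 0) as [Z|Z].
- apply quot_limit; [easy|now apply Hd|].
  apply (filterlim_ext_loc E).
  + unfold within; revert HN; apply filter_imp; intros q Hq HD.
    rewrite Hq; now field.
  + apply (filterlim_filter_le_1 (F := locally p)); [apply filter_le_within|exact HE].
- rewrite quot_regular by easy.
  rewrite (locally_singleton _ _ HN); now field.
Qed.

(** Generic points are found along a path leaving the given point. *)
Lemma locally_path {U : UniformSpace} (g : R -> U) (P : U -> Prop) :
  continuous g 0 -> locally (g 0) P -> at_right 0 (fun e => P (g e)).
Proof. intros Hg HP; apply (filter_le_within (F := locally 0) (Rlt 0) (fun e => P (g e))); exact (Hg _ HP). Qed.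

Lemma locally_path_exists {U : UniformSpace} (g : R -> U) (P : U -> Prop) :
  continuous g 0 -> locally (g 0) P -> exists e, 0 < e /\ P (g e).
Proof.
intros Hg HP; pose proof (locally_path g P Hg HP) as H.
destruct (filter_ex _ (filter_and _ _ H pos_at_right_0)) as [e [He Hpos]].
now exists e.
Qed.

Lemma continuous_diagonal (u v : R) : continuous (fun e => (u + e, v + e)) 0.
Proof.
apply (continuous_comp_2 (fun e => u + e) (fun e => v + e) pair).
- apply ex_derive_continuous_R; auto_derive; easy.
- apply ex_derive_continuous_R; auto_derive; easy.
- apply (continuous_ext (fun z => z)); [now intros []|apply continuous_id].
Qed.

Lemma locally_quadrant (u v : R) :
  0 < u -> 0 < v -> locally (u, v) (fun q => 0 < fst q /\ 0 < snd q).
Proof.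
intros Hu Hv; apply filter_and.
- apply (loc_cont_pos (fun q : R * R => fst q)); [solve_loc_cont|easy].
- apply (loc_cont_pos (fun q : R * R => snd q)); [solve_loc_cont|easy].
Qed.

(** Density of [D <> 0] is tested along the diagonal direction [(u + e, v + e)]:
    each of the denominators [uv - 1], [1/u - v], [u - 1], [uv - u], ... that
    vanishes at a positive point is nonzero further along it. *)
Lemma quot2_eq (N D E : R -> R -> R) (u v : R) :
  0 < u -> 0 < v ->
  (forall x y, 0 < x -> 0 < y -> N x y = E x y * D x y) ->
  loc_cont (fun q : R * R => E (fst q) (snd q)) (u, v) ->
  (D u v = 0 -> forall e, 0 < e -> D (u + e) (v + e) <> 0) ->
  quot2 N D u v = E u v.
Proof.
intros Hu Hv HN HE Hd; unfold quot2.
rewrite (quot_eq _ _ (fun q : R * R => E (fst q) (snd q))); [easy| | |].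
- refine (filter_imp _ _ _ (locally_quadrant u v Hu Hv)).
  intros q [H1 H2]; now apply HN.
- now apply loc_cont_continuous.
- simpl; intros Z P HP.
  destruct (locally_path_exists (fun e => (u + e, v + e)) P) as [e [He HPe]].
  + apply continuous_diagonal.
  + now rewrite !Rplus_0_r.
  + exists (u + e, v + e); split; [easy|now apply Hd].
Qed.

Lemma quot_power_slope (c u : R) :
  0 < u ->
  quot (fun w : R => Rpower w c - 1) (fun w : R => w - 1) u = pow_slope c u 1.
Proof.
intros Hu; destruct (has_slope_Rpower c) as [H1 H2].
apply (quot_eq (fun w : R => Rpower w c - 1) (fun w => w - 1) (fun w => pow_slope c w 1)).
- assert (Hid : loc_cont (fun y : R => y) u) by solve_loc_cont.
  refine (filter_imp _ _ _ (loc_cont_pos _ _ Hid Hu)); intros w Hw.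
  rewrite <- H1 by lra; f_equal.
  unfold Rpower; now rewrite ln_1, Rmult_0_r, exp_0.
- apply loc_cont_continuous.
  apply (loc_cont_pair (fun w => w) (fun _ => 1) (pow_slope c));
    [solve_loc_cont|solve_loc_cont|apply H2; lra].
- intros Z P HP.
  destruct (locally_path_exists (fun e => u + e) P) as [e [He HPe]].
  + apply ex_derive_continuous_R; auto_derive; easy.
  + now rewrite Rplus_0_r.
  + exists (u + e); split; [easy|lra].
Qed.

Lemma Rpower_1_l (c : R) : Rpower 1 c = 1.
Proof. unfold Rpower; now rewrite ln_1, Rmult_0_r, exp_0. Qed.

Lemma Rpower_inv (x c : R) : 0 < x -> Rpower (/ x) c = / Rpower x c.
Proof.
intros Hx; unfold Rpower; rewrite ln_Rinv, <- exp_Ropp by easy; f_equal; ring.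
Qed.

(** * The function T *)

Lemma T_Dphi_integral (a u : R) :
  0 < a -> 0 < u ->
  T_Dphi u (2 * a) =
  - K_Dk 1 (2 * a) * pow_slope (- a) u 1
  + - (2 * Gamma (a + 2) / a) *
    RInt (fun p => RInt (H_integrand a u 1 p) 0 1) 0 1.
Proof.
intros Ha Hu; unfold T_Dphi; replace (- (2 * a) / 2) with (- a) by field.
rewrite quot_power_slope by easy.
rewrite H_Dk_integral by (try apply Rinv_0_lt_compat; lra).
now rewrite Rinv_r by lra.
Qed.

Lemma T_Dphi_slope (a : R) :
  0 < a -> exists D, has_slope (fun u => T_Dphi u (2 * a)) D.
Proof.
intros Ha.
destruct (has_slope_pow_slope (- a)) as [D1 H1], (has_slope_H_diagonal a) as [D2 H2].
eexists; eapply has_slope_ext; [|apply (has_slope_lin _ _ _ _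
   (- K_Dk 1 (2 * a)) (- (2 * Gamma (a + 2) / a)) H1 H2)].
intros u Hu; symmetry; now apply T_Dphi_integral.
Qed.

(** The closed form of [T(u) / Gamma (a + 1)], with [P] standing for [u^(-a)]. *)
Definition T_closed (a u P : R) : R :=
  - ((2 - a) / (6 * a)) * ((P - 1) / (u - 1))
  + 2 * ((2 - a) / (6 * a)) / (1 - u)
  - 2 / (a ^ 2 * (1 - u) ^ 2) *
    (((a - 1) - (a - 2) * u - u ^ 2 * P) / ((a - 1) * (1 - u) ^ 2) - (1 - a / 2)).

Lemma T_Dphi_value (a u : R) :
  1 < a -> 0 < u -> u <> 1 ->
  T_Dphi u (2 * a) = Gamma (a + 1) * T_closed a u (Rpower u (- a)).
Proof.
intros Ha Hu Hu1; unfold T_Dphi; replace (- (2 * a) / 2) with (- a) by field.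
rewrite quot_regular by lra.
rewrite H_Dk_reduction by (try apply Rinv_0_lt_compat; lra).
rewrite Rinv_r, K_Dk_value_1, Q_value, Q_value_1, Rpower_1_l by lra.
unfold T_closed; field; repeat split; lra.
Qed.

(** * The two equations at generic points *)

Lemma H_Dk_value (a u v : R) :
  1 < a -> 0 < u -> 0 < v -> u <> 1 -> v <> 1 -> u * v <> 1 ->
  let P := Rpower u (- a) in
  let V := Rpower v (- a) in
  let w := u * v in
  H_Dk u v (2 * a) =
  Gamma (a + 1) *
  (2 * ((2 - a) * w + a - P * V * (a * w ^ 2 + (2 - a) * w))
     / (a ^ 2 * (a - 1) * (w - 1) ^ 3) / (1 - u)
   - 2 / (a ^ 2 * (1 - u) ^ 2) *
     (((a - 1) * w ^ 2 * (P * V) - (a - 2) * w * u * (P * V) - u ^ 2 * P)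
        / ((a - 1) * (w - u) ^ 2)
      - ((a - 1) * w ^ 2 * (P * V) - (a - 2) * w * (P * V) - 1)
        / ((a - 1) * (w - 1) ^ 2))).
Proof.
intros Ha Hu Hv Hu1 Hv1 Huv; cbv zeta.
assert (Hw : 0 < u * v) by nra.
assert (Hwu : u <> u * v) by (intros E; apply Hv1; apply Rmult_eq_reg_l with u; lra).
rewrite H_Dk_reduction by lra.
rewrite K_Dk_value, !Q_value, Rpower_1_l, <- !Rpower_mult_distr by lra.
field; repeat split; lra.
Qed.

Lemma K_identity_generic (a u : R) :
  1 < a -> 0 < u -> u <> 1 ->
  (1 - a) * K_Dk u (2 * a) =
  - T_Dphi u (2 * a) - Rpower u (- a - 1) * T_Dphi (/ u) (2 * a).
Proof.
intros Ha Hu Hu1.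
assert (Hi : / u <> 1) by (intros E; apply Hu1; rewrite <- (Rinv_inv u), E; field).
rewrite K_Dk_value, !T_Dphi_value by (try apply Rinv_0_lt_compat; lra).
rewrite Rpower_pred, Rpower_inv by easy; unfold T_closed.
pose proof (Rpower_pos u (- a)).
field; repeat split; lra.
Qed.

(** The sum of the four terms with every extended quotient replaced by a slope:
    [DT] is a slope function of T, and [DW] one of [x^j T(1/x)]. *)
Definition II_slopes (T : R -> R) (DT DW : R -> R -> R) (j u v : R) : R :=
  T u * pow_slope j (u * v) 1
  + (Rpower u (j - 1) * DT (/ u) v - u * Rpower (u * v) (j - 1) * DT (/ v) u)
  + (- (pow_slope j u 1 * T v) + v * DT (u * v) v - DT (u * v) u)
  + (- (pow_slope j u 1 * Rpower v j * T (/ v)) - DW (u * v) u + v * DW (u * v) v).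

Lemma slope_quotient (f : R -> R) (D : R -> R -> R) (x y : R) :
  has_slope f D -> 0 < x -> 0 < y -> x <> y -> D x y = (f x - f y) / (x - y).
Proof. intros [H _] Hx Hy Hxy; rewrite H by easy; field; lra. Qed.

Lemma H_identity_generic (a u v : R) (DT DW : R -> R -> R) :
  1 < a -> 0 < u -> 0 < v -> u <> 1 -> v <> 1 -> u * v <> 1 ->
  let j := - a - 1 in
  let T := fun w => T_Dphi w (2 * a) in
  has_slope T DT -> has_slope (fun x => Rpower x j * T (/ x)) DW ->
  (1 - a) * H_Dk u v (2 * a) = II_slopes T DT DW j u v.
Proof.
intros Ha Hu Hv Hu1 Hv1 Huv j T HT HW.
assert (Hw : 0 < u * v) by nra.
assert (Iu : 0 < / u) by now apply Rinv_0_lt_compat.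
assert (Iv : 0 < / v) by now apply Rinv_0_lt_compat.
assert (Iw : 0 < / (u * v)) by now apply Rinv_0_lt_compat.
assert (Iu1 : / u <> 1) by (intros E; apply Hu1; rewrite <- (Rinv_inv u), E; field).
assert (Iv1 : / v <> 1) by (intros E; apply Hv1; rewrite <- (Rinv_inv v), E; field).
assert (Iw1 : / (u * v) <> 1)
  by (intros E; apply Huv; rewrite <- (Rinv_inv (u * v)), E; field).
assert (Hwu : u * v <> u) by (intros E; apply Hv1; apply Rmult_eq_reg_l with u; lra).
assert (Hwv : u * v <> v) by (intros E; apply Hu1; apply Rmult_eq_reg_r with v; lra).
assert (Huv' : / u <> v) by (intros E; apply Huv; rewrite <- E; field; lra).
assert (Hvu' : / v <> u) by (intros E; apply Huv; rewrite <- E; field; lra).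
unfold II_slopes.
rewrite !(slope_quotient _ _ _ _ HT), !(slope_quotient _ _ _ _ HW),
  !(slope_quotient _ _ _ _ (has_slope_Rpower j)) by (easy || lra).
unfold T, j; rewrite H_Dk_value by easy.
rewrite !T_Dphi_value by easy.
rewrite !Rpower_1_l, !(Rpower_pred _ (- a - 1)), !(Rpower_pred _ (- a)), !Rpower_inv,
  <- !Rpower_mult_distr by easy.
unfold T_closed.
pose proof (Rpower_pos u (- a)); pose proof (Rpower_pos v (- a)).
(* From here on u, v, u^(-a), v^(-a) are independent variables. *)
generalize dependent (Rpower u (- a)); intros P HP.
generalize dependent (Rpower v (- a)); intros V HV.
generalize (Gamma (a + 1)); intros g.
field; repeat split; try lra.
Qed.

(** * Continuity of both sides and the exceptional points *)

Lemma loc_cont_K_Dk (a u : R) :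
  0 < a -> 0 < u -> loc_cont (fun s => K_Dk s (2 * a)) u.
Proof.
intros Ha Hu.
apply (loc_cont_ext_loc (fun s => Gamma (a + 1) / a * RInt (K_integrand a s) 0 1)).
- assert (Hid : loc_cont (fun y : R => y) u) by solve_loc_cont.
  refine (filter_imp _ _ _ (loc_cont_pos _ _ Hid Hu)); intros s Hs.
  symmetry; now apply K_Dk_integral.
- apply loc_cont_mult; [solve_loc_cont|].
  apply loc_cont_RInt; intros t Ht; unfold K_integrand; cbv zeta.
  solve_loc_cont; apply convex_pos; simpl; lra.
Qed.

Lemma loc_cont_H_Dk (a u v : R) :
  0 < a -> 0 < u -> 0 < v ->
  loc_cont (fun q : R * R => H_Dk (fst q) (snd q) (2 * a)) (u, v).
Proof.
intros Ha Hu Hv.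
apply (loc_cont_ext_loc (fun q : R * R => - (2 * Gamma (a + 2) / a) *
  RInt (fun p => RInt (H_integrand a (fst q) (fst q * snd q) p) 0 1) 0 1)).
- refine (filter_imp _ _ _ (locally_quadrant u v Hu Hv)); intros q [H1 H2].
  symmetry; now apply H_Dk_integral.
- apply loc_cont_mult; [solve_loc_cont|].
  apply (loc_cont_RInt (fun (q : R * R) p =>
           RInt (H_integrand a (fst q) (fst q * snd q) p) 0 1)); intros p Hp.
  apply (loc_cont_RInt (fun (q : R * R * R) =>
           H_integrand a (fst (fst q)) (fst (fst q) * snd (fst q)) (snd q))); intros r Hr.
  unfold H_integrand, barycentre; cbv zeta; solve_loc_cont.
  simpl; apply barycentre_pos; [lra|nra|lra|lra].
Qed.

Lemma loc_cont_slope {U : UniformSpace} (D : R -> R -> R) (f : R -> R) (g h : U -> R) (q : U) :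
  has_slope f D -> loc_cont g q -> loc_cont h q -> 0 < g q -> 0 < h q ->
  loc_cont (fun z => D (g z) (h z)) q.
Proof.
intros [_ HD] Hg Hh Pg Ph; apply (loc_cont_pair g h D); [easy|easy|now apply HD].
Qed.

Lemma loc_cont_slope_comp {U : UniformSpace} (f : R -> R) (D : R -> R -> R)
  (g : U -> R) (q : U) :
  has_slope f D -> loc_cont g q -> 0 < g q -> loc_cont (fun z => f (g z)) q.
Proof.
intros Hf Hg Pg; apply (loc_cont_comp g f); [easy|now apply has_slope_loc_cont with D].
Qed.

Ltac solve_slopes :=
  cbv beta;
  lazymatch goal with
  | |- loc_cont (fun z => @?f z + @?g z) _ => apply (loc_cont_plus f g); solve_slopes
  | |- loc_cont (fun z => @?f z - @?g z) _ => apply (loc_cont_minus f g); solve_slopes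
  | |- loc_cont (fun z => @?f z * @?g z) _ => apply (loc_cont_mult f g); solve_slopes
  | |- loc_cont (fun z => - @?f z) _ => apply (loc_cont_opp f); solve_slopes
  | H : has_slope _ ?D |- loc_cont (fun z => ?D (@?g z) (@?h z)) _ =>
      apply (loc_cont_slope D _ g h _ H); [solve_loc_cont|solve_loc_cont| |]
  | H : has_slope ?f ?D |- loc_cont (fun z => ?f (@?g z)) _ =>
      apply (loc_cont_slope_comp f D g _ H); [solve_loc_cont|]
  | |- _ => solve_loc_cont
  end.

Lemma loc_cont_II_slopes (T : R -> R) (DT DW : R -> R -> R) (j u v : R) :
  has_slope T DT -> has_slope (fun x => Rpower x j * T (/ x)) DW ->
  0 < u -> 0 < v ->
  loc_cont (fun q : R * R => II_slopes T DT DW j (fst q) (snd q)) (u, v).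
Proof.
intros HT HW Hu Hv; pose proof (has_slope_Rpower j) as HP.
assert (Hw : 0 < u * v) by nra.
assert (Iu : 0 < / u) by now apply Rinv_0_lt_compat.
assert (Iv : 0 < / v) by now apply Rinv_0_lt_compat.
unfold II_slopes; solve_slopes; simpl; easy || lra.
Qed.

Lemma II_sum_slopes (T : R -> R) (DT DW : R -> R -> R) (j u v : R) :
  has_slope T DT -> has_slope (fun x => Rpower x j * T (/ x)) DW ->
  0 < u -> 0 < v ->
  II1 T j u v + II2 T j u v + II3 T j u v + II4 T j u v = II_slopes T DT DW j u v.
Proof.
intros HT HW Hu Hv; pose proof (has_slope_Rpower j) as HP.
assert (Hw : 0 < u * v) by nra.
assert (Iu : 0 < / u) by now apply Rinv_0_lt_compat.
assert (Iv : 0 < / v) by now apply Rinv_0_lt_compat.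
assert (P1 : forall x, 0 < x -> Rpower x j - 1 = pow_slope j x 1 * (x - 1))
  by (intros; rewrite <- (proj1 HP), Rpower_1_l by lra; easy).
assert (T1 : forall x y, 0 < x -> 0 < y -> T x - T y = DT x y * (x - y)) by apply HT.
assert (W1 : forall x y, 0 < x -> 0 < y ->
  Rpower x j * T (/ x) - Rpower y j * T (/ y) = DW x y * (x - y)) by apply HW.
assert (Hi : forall x, 0 < x -> 0 < / x) by apply Rinv_0_lt_compat.
assert (Hm : forall x y, 0 < x -> 0 < y -> 0 < x * y) by (intros; nra).
unfold II1, II2, II3, II4, II_slopes.
rewrite (quot2_eq _ _ (fun u v => pow_slope j (u * v) 1));
  [|easy|easy|intros x y Hx Hy; apply P1; auto
   |solve_slopes; simpl; easy || lra|intros; nra].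
assert (Dinv : forall x y, 0 < x -> 0 < y -> / x - y = 0 ->
          forall e, 0 < e -> / (x + e) - (y + e) <> 0).
{ intros x y Hx Hy Z e He.
  assert (/ (x + e) < / x) by (apply Rinv_lt_contravar; nra); lra. }
rewrite (quot2_eq _ _ (fun u v => Rpower u (j - 1) * DT (/ u) v));
  [|easy|easy|intros x y Hx Hy; rewrite T1 by auto; ring
   |solve_slopes; simpl; easy || lra|intros Z; now apply Dinv].
rewrite (quot2_eq _ _ (fun u v => u * Rpower (u * v) (j - 1) * DT (/ v) u));
  [|easy|easy|intros x y Hx Hy; rewrite T1 by auto; ring
   |solve_slopes; simpl; easy || lra|intros Z; now apply (Dinv v u)].
rewrite (quot2_eq _ _ (fun u v => pow_slope j u 1 * T v));
  [|easy|easy|intros x y Hx Hy; rewrite P1 by auto; ring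
   |solve_slopes; simpl; easy || lra|intros; nra].
rewrite (quot2_eq _ _ (fun u v => v * DT (u * v) v));
  [|easy|easy|intros x y Hx Hy; rewrite T1 by auto; ring
   |solve_slopes; simpl; easy || lra|].
2:{ intros Z e He; assert (u = 1) by nra; subst u; nra. }
rewrite (quot2_eq _ _ (fun u v => DT (u * v) u));
  [|easy|easy|intros x y Hx Hy; rewrite T1 by auto; ring
   |solve_slopes; simpl; easy || lra|].
2:{ intros Z e He; assert (v = 1) by nra; subst v; nra. }
rewrite (quot2_eq _ _ (fun u v => pow_slope j u 1 * Rpower v j * T (/ v)));
  [|easy|easy|intros x y Hx Hy; rewrite P1 by auto; ring
   |solve_slopes; simpl; easy || lra|intros; nra].
rewrite (quot2_eq _ _ (fun u v => DW (u * v) u));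
  [|easy|easy|intros x y Hx Hy; rewrite W1 by auto; ring
   |solve_slopes; simpl; easy || lra|].
2:{ intros Z e He; assert (v = 1) by nra; subst v; nra. }
rewrite (quot2_eq _ _ (fun u v => v * DW (u * v) v));
  [|easy|easy|intros x y Hx Hy; rewrite W1 by auto; ring
   |solve_slopes; simpl; easy || lra|].
2:{ intros Z e He; assert (u = 1) by nra; subst u; nra. }
ring.
Qed.

Lemma eq_0_along_path {U : UniformSpace} (f : U -> R) (g : R -> U) :
  continuous g 0 -> continuous f (g 0) ->
  at_right 0 (fun e => f (g e) = 0) -> f (g 0) = 0.
Proof.
intros Hg Hf H.
apply (filterlim_locally_unique (V := R_NormedModule) (F := at_right 0) (fun e => f (g e))).
- apply (filterlim_filter_le_1 (F := locally 0)); [apply filter_le_within|].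
  now apply (continuous_comp g f).
- apply (filterlim_ext_loc (fun _ => 0)); [|apply filterlim_const].
  revert H; now apply filter_imp.
Qed.

Lemma at_right_avoid (f : R -> R) (c : R) :
  continuous f 0 -> (f 0 = c -> forall e, 0 < e -> f e <> c) ->
  at_right 0 (fun e => f e <> c).
Proof.
intros Hf Hc; destruct (Req_dec (f 0) c) as [E|E].
- refine (filter_imp _ _ _ pos_at_right_0); exact (Hc E).
- apply (locally_path f (fun x => x <> c)); [easy|now apply open_neq].
Qed.

(** The theorem for every real [m = 2 a > 2].  Moving along [u + e], or along
    [(u + e, v + e)], the excluded equations u = 1, v = 1, uv = 1 fail for all small
    [e > 0], so the differences of the two sides vanish there and hence at e = 0. *)
Lemma modular_curvature_identity (a u v : R) :
  1 < a -> 0 < u -> 0 < v ->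
  let j := - a - 1 in
  let T := fun w => T_Dphi w (2 * a) in
  (1 - a) * K_Dk u (2 * a) = - T u - Rpower u j * T (/ u) /\
  (1 - a) * H_Dk u v (2 * a) = II1 T j u v + II2 T j u v + II3 T j u v + II4 T j u v.
Proof.
intros Ha Hu Hv j T.
destruct (T_Dphi_slope a ltac:(lra)) as [DT HT]; fold T in HT.
pose proof (has_slope_inversion j T DT HT) as HW.
assert (Iu : 0 < / u) by now apply Rinv_0_lt_compat.
assert (Avoid : forall x, at_right 0 (fun e => x + e <> 1)).
{ intros x; apply (at_right_avoid (fun e => x + e)).
  - apply ex_derive_continuous_R; auto_derive; easy.
  - intros; lra. }
assert (Apos : forall x, 0 < x -> at_right 0 (fun e => 0 < x + e)).
{ intros x Hx; refine (filter_imp _ _ _ pos_at_right_0); intros; lra. }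
split.
- pose proof (eq_0_along_path
    (fun x => (1 - a) * K_Dk x (2 * a) - (- T x - Rpower x j * T (/ x))) (fun e => u + e)) as E.
  cbv beta in E; rewrite !Rplus_0_r in E; apply Rminus_diag_uniq, E; clear E.
  + apply ex_derive_continuous_R; auto_derive; easy.
  + apply loc_cont_continuous.
    apply loc_cont_minus.
    * apply loc_cont_mult; [solve_loc_cont|apply loc_cont_K_Dk; lra].
    * assert (loc_cont (fun x : R => / x) u) by (solve_loc_cont; easy).
      apply loc_cont_minus; [apply loc_cont_opp; now apply has_slope_loc_cont with DT|].
      exact (has_slope_loc_cont _ _ u HW Hu).
  + refine (filter_imp _ _ _ (filter_and _ _ (Avoid u) (Apos u Hu))).
    intros e [He Pe]; apply Rminus_diag_eq; exact (K_identity_generic a (u + e) Ha Pe He).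
- rewrite (II_sum_slopes T DT _ j u v HT HW Hu Hv).
  set (DW := fun x y => _) in HW.
  pose proof (eq_0_along_path
    (fun q : R * R => (1 - a) * H_Dk (fst q) (snd q) (2 * a)
              - II_slopes T DT DW j (fst q) (snd q)) (fun e => (u + e, v + e))) as E.
  cbv beta in E; simpl fst in E; simpl snd in E; rewrite !Rplus_0_r in E.
  apply Rminus_diag_uniq, E; clear E.
  + apply continuous_diagonal.
  + apply loc_cont_continuous, loc_cont_minus.
    * apply loc_cont_mult; [solve_loc_cont|apply loc_cont_H_Dk; lra].
    * now apply loc_cont_II_slopes.
  + assert (Auv : at_right 0 (fun e => (u + e) * (v + e) <> 1)).
    { apply (at_right_avoid (fun e => (u + e) * (v + e))).
      - apply ex_derive_continuous_R; auto_derive; easy.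
      - rewrite !Rplus_0_r; intros; nra. }
    refine (filter_imp _ _ _ (filter_and _ _ Auv (filter_and _ _
      (filter_and _ _ (Avoid u) (Avoid v)) (filter_and _ _ (Apos u Hu) (Apos v Hv))))).
    intros e [Huv [[H1 H2] [H3 H4]]]; apply Rminus_diag_eq;
      exact (H_identity_generic a _ _ DT DW Ha H3 H4 H1 H2 Huv HT HW).
Qed.

Theorem theorem4p6 (m : nat) (hm : (2 < m)%nat) (u v : R) (hu : 0 < u) (hv : 0 < v) :
  let j := - INR m / 2 - 1 in
  let T := fun w : R => T_Dphi w (INR m) in
  (2 - INR m) / 2 * K_Dk u (INR m) = - T u - Rpower u j * T (/ u)
  /\
  (2 - INR m) / 2 * H_Dk u v (INR m)
    = II1 T j u v + II2 T j u v + II3 T j u v + II4 T j u v.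
Proof.
assert (Ha : 1 < INR m / 2) by (apply lt_INR in hm; simpl in hm; lra).
pose proof (modular_curvature_identity (INR m / 2) u v Ha hu hv) as H.
cbv zeta in H |- *.
replace (2 * (INR m / 2)) with (INR m) in H by field.
replace (- INR m / 2 - 1) with (- (INR m / 2) - 1) by field.
replace ((2 - INR m) / 2) with (1 - INR m / 2) by field.
exact H.
Qed.
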